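(* Let $-A$ be the generator of a $C_0$-semigroup $(e^{-tA})_{t\ge 0}$ on a complex Banach space $X$. Suppose that $$M:=\sup_{t\ge 0}\|e^{-tA}\|<\infty .$$ For any $\alpha\in(0,2]$ and $x\in D_\infty^\alpha$, $$\|\Delta_{n,t}(A)x\|\le 8\,M\left(\frac{t}{\sqrt n}\right)^\alpha\|x\|_{D_\infty^\alpha},\qquad n\in\mathbb N,\ t>0.$$
   Context: For $n\in\mathbb N$, $t>0$: $\Delta_{n,t}(A):=\left(1+\frac tn A\right)^{-n}-e^{-tA}$. For $\alpha\in(0,2]$, the (Komatsu) space $D_\infty^\alpha$ is $$D_\infty^\alpha:=\left\{x\in X:\ \|x\|_{D_\infty^\alpha}:=\|x\|+\sup_{\lambda>0}\lambda^\alpha\big\|[A(A+\lambda)^{-1}]^2x\big\|<\infty\right\}.$$ *)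

(* Defs.v *)
From Stdlib Require Import Reals.
From Coquelicot Require Export Coquelicot.
Open Scope R_scope.
Set Implicit Arguments.

(* A not necessarily everywhere defined operator in X: only the values of
   [op_app] on [op_dom] are meaningful. *)
Record operator (X : CompleteNormedModule C_AbsRing) : Type := Operator {
  op_dom : X -> Prop;
  op_app :> X -> X
}.

Arguments Operator {X} _ _.

Section Operators.
Context {X : CompleteNormedModule C_AbsRing}.

Definition op_total (f : X -> X) : operator X := Operator (fun _ => True) f.

Definition op_id : operator X := op_total (fun x => x).

Definition op_plus (A B : operator X) : operator X :=
  Operator (fun x => op_dom A x /\ op_dom B x) (fun x => plus (A x) (B x)).

Definition op_minus (A B : operator X) : operator X :=
  Operator (fun x => op_dom A x /\ op_dom B x) (fun x => minus (A x) (B x)).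

Definition op_opp (A : operator X) : operator X :=
  Operator (op_dom A) (fun x => opp (A x)).

Definition op_scal (c : C) (A : operator X) : operator X :=
  Operator (op_dom A) (fun x => scal (c : C_AbsRing) (A x)).

Definition op_comp (A B : operator X) : operator X :=
  Operator (fun x => op_dom B x /\ op_dom A (B x)) (fun x => A (B x)).

Fixpoint op_pow (A : operator X) (n : nat) : operator X :=
  match n with
  | O => op_id
  | S m => op_comp A (op_pow A m)
  end.

(* For injective A the domain of the inverse is the range of A. *)
Definition op_inv (A : operator X) : operator X :=
  Operator (fun y => exists! x, op_dom A x /\ A x = y)
           (fun y => iota (fun x => op_dom A x /\ A x = y)).

Definition op_norm (f : X -> X) : Rbar :=
  Lub_Rbar (fun r => exists x, norm x <= 1 /\ r = norm (f x)).

(* Only the times t >= 0 matter; T is arbitrary at negative times. *)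
Record C0_semigroup (T : R -> X -> X) : Prop := {
  C0_linear : forall t, 0 <= t -> is_linear (T t);
  C0_zero : forall x, T 0 x = x;
  C0_add : forall s t x, 0 <= s -> 0 <= t -> T (s + t) x = T s (T t x);
  C0_continuous : forall x, filterlim (fun t => T t x) (at_right 0) (locally x)
}.

Definition semigroup_sup (T : R -> X -> X) : Rbar :=
  Rbar_lub (fun r => exists t, 0 <= t /\ r = op_norm (T t)).

Definition diff_quotient (T : R -> X -> X) (x : X) (t : R) : X :=
  scal (RtoC (/ t) : C_AbsRing) (minus (T t x) x).

Definition is_generator (T : R -> X -> X) (B : operator X) : Prop :=
  (forall x, op_dom B x <->
     exists y, filterlim (diff_quotient T x) (at_right 0) (locally y)) /\
  (forall x, op_dom B x ->
     filterlim (diff_quotient T x) (at_right 0) (locally (B x))).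

(* [A (A + lambda)^-1]^2 *)
Definition komatsu_op (A : operator X) (lambda : R) : operator X :=
  op_pow (op_comp A (op_inv (op_plus A (op_scal (RtoC lambda) op_id)))) 2.

(* When -A generates a bounded C_0-semigroup, [komatsu_op A lambda] is
   everywhere defined for lambda > 0 (Hille-Yosida), so no domain condition
   is imposed on x. *)
Definition komatsu_norm (A : operator X) (alpha : R) (x : X) : Rbar :=
  Rbar_plus (norm x)
    (Lub_Rbar (fun r => exists lambda, 0 < lambda /\
       r = Rpower lambda alpha * norm (komatsu_op A lambda x))).

Definition komatsu_space (A : operator X) (alpha : R) (x : X) : Prop :=
  Rbar_lt (komatsu_norm A alpha x) p_infty.

(* (1 + (t/n) A)^-n - e^{-tA}, where T t stands for e^{-tA} *)
Definition euler_error (A : operator X) (T : R -> X -> X) (n : nat) (t : R) :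
    operator X :=
  op_minus
    (op_pow (op_inv (op_plus op_id (op_scal (RtoC (t / INR n)) A))) n)
    (op_total (T t)).

End Operators.

(* Main.v *)
Require Import Defs.
From Stdlib Require Import Reals Lra Lia List Classical.
From Coquelicot Require Import Coquelicot.
Open Scope R_scope.

(** Write [D] for the Euler error (1 + (t/n) A)^-n - e^(-tA), let [s = t / sqrt n]
    and [l = 1 / s]. For [x] in the Komatsu space put [u = (A + l)^-2 x] and
    [w = A^2 u = (A (A + l)^-1)^2 x]. Expanding [x = (A + l)^2 u] gives

      [D x = D w + 2 l D (A u) + l^2 D u],

    and it is enough to bound each term by a multiple of [M |w|], since the
    Komatsu norm [N] of [x] gives [|w| <= s^alpha N]. The three terms are
    controlled by three estimates on [D]:
    - [|D w| <= 2 M |w|];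
    - [|D v| <= 2 s M |A v|] for [v] in the domain of [A]
      ([euler_defect_first_order]);
    - [|D u| <= (s^2 / 2) M |A^2 u|] for [u] in the domain of [A^2]
      ([euler_defect_second_order]).
    The total is [(2 + 4 + 1/2) M |w|], below [8 M |w|].

    To have only one factor [M], bounds are stated for whole orbits: the least
    [K] with [|T t x| <= K] for all [t >= 0] is an equivalent norm of [x], at most
    [M |x|], for which the semigroup and the resolvents (1 + h A)^-1 are
    contractions ([resolvent_contraction]). The second-order estimate is then
    the usual telescoping of one-step errors of size [h^2 / 2] for
    [h = t / n] ([euler_one_step]), and the first-order one follows from it
    by replacing [v] with the average of its orbit over [[0, s]].

    All this is real analysis, carried out in a real Banach space and applied
    to the underlying real space of [X]. Derivatives of orbits are controlled
    by a mean value inequality for right derivatives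
    ([right_mean_value]), and integration serves to build the average of an
    orbit and the resolvent, as a Laplace transform
    ([neg_generator_resolvent_exists]). *)

(** * Identities between linear combinations *)

Inductive lin_expr : Type :=
| LVar (i : nat)
| LZero
| LPlus (e f : lin_expr)
| LOpp (e : lin_expr)
| LScal (a : R) (e : lin_expr).

Section LinearCombinations.
Context {E : ModuleSpace R_AbsRing}.

Fixpoint lin_eval (l : list E) (e : lin_expr) : E :=
  match e with
  | LVar i => nth i l zero
  | LZero => zero
  | LPlus e f => plus (lin_eval l e) (lin_eval l f)
  | LOpp e => opp (lin_eval l e)
  | LScal a e => scal a (lin_eval l e)
  end.

Fixpoint lin_coef (e : lin_expr) (i : nat) : R :=
  match e with
  | LVar j => if Nat.eqb i j then 1 else 0
  | LZero => 0
  | LPlus e f => lin_coef e i + lin_coef f i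
  | LOpp e => - lin_coef e i
  | LScal a e => a * lin_coef e i
  end.

Fixpoint lin_comb (l : list E) (c : nat -> R) : E :=
  match l with
  | nil => zero
  | x :: l => plus (scal (c 0%nat) x) (lin_comb l (fun i => c (S i)))
  end.

Fixpoint coef_agree (n : nat) (c d : nat -> R) : Prop :=
  match n with
  | O => True
  | S n => c 0%nat = d 0%nat /\ coef_agree n (fun i => c (S i)) (fun i => d (S i))
  end.

Lemma lin_comb_agree (l : list E) : forall c d,
  coef_agree (length l) c d -> lin_comb l c = lin_comb l d.
Proof.
induction l as [|x l IH]; simpl; intros c d H; [easy|].
destruct H as [H0 H]; now rewrite H0, (IH _ _ H).
Qed.

Lemma lin_comb_zero (l : list E) : lin_comb l (fun _ => 0) = zero.
Proof.
induction l as [|x l IH]; simpl; [easy|].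
rewrite IH, plus_zero_r; exact (scal_zero_l x).
Qed.

Lemma lin_comb_plus (l : list E) : forall c d,
  lin_comb l (fun i => c i + d i) = plus (lin_comb l c) (lin_comb l d).
Proof.
induction l as [|x l IH]; simpl; intros c d.
- now rewrite plus_zero_l.
- rewrite (IH (fun i => c (S i)) (fun i => d (S i))).
  rewrite (scal_distr_r (c 0%nat) (d 0%nat) x :
             scal (c 0%nat + d 0%nat) x = _).
  rewrite <- !plus_assoc; f_equal.
  now rewrite plus_assoc, (plus_comm (scal (d 0%nat) x)), <- plus_assoc.
Qed.

Lemma lin_comb_scal (a : R) (l : list E) : forall c,
  lin_comb l (fun i => a * c i) = scal a (lin_comb l c).
Proof.
induction l as [|x l IH]; simpl; intros c.
- now rewrite scal_zero_r.
- rewrite (IH (fun i => c (S i))), scal_distr_l, scal_assoc; reflexivity.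
Qed.

Lemma lin_comb_opp (l : list E) (c : nat -> R) :
  lin_comb l (fun i => - c i) = opp (lin_comb l c).
Proof.
rewrite <- scal_opp_one, <- lin_comb_scal.
apply lin_comb_agree; generalize c; clear c.
induction (length l); simpl; intros c; [easy|]; split; [|apply IHn].
unfold opp, one; simpl; ring.
Qed.

Lemma lin_comb_var (l : list E) : forall j,
  lin_comb l (fun i => if Nat.eqb i j then 1 else 0) = nth j l zero.
Proof.
induction l as [|x l IH]; intros [|j]; simpl; try easy.
- rewrite lin_comb_zero, plus_zero_r; exact (scal_one x).
- rewrite IH, (scal_zero_l x : scal 0 x = zero); apply plus_zero_l.
Qed.

Lemma lin_eval_comb (l : list E) (e : lin_expr) :
  lin_eval l e = lin_comb l (lin_coef e).
Proof.
induction e; simpl.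
- now rewrite lin_comb_var.
- now rewrite lin_comb_zero.
- now rewrite lin_comb_plus, IHe1, IHe2.
- now rewrite lin_comb_opp, IHe.
- now rewrite lin_comb_scal, IHe.
Qed.

Lemma lin_eval_eq (l : list E) (e f : lin_expr) :
  coef_agree (length l) (lin_coef e) (lin_coef f) ->
  lin_eval l e = lin_eval l f.
Proof. intros H; rewrite !lin_eval_comb; now apply lin_comb_agree. Qed.

End LinearCombinations.

Ltac lin_index x l :=
  lazymatch l with
  | x :: _ => constr:(Some O)
  | _ :: ?l =>
      lazymatch lin_index x l with
      | Some ?i => constr:(Some (S i))
      | None => constr:(@None nat)
      end
  | _ => constr:(@None nat)
  end.

(* The list of atoms starts as [tt], so that its type is that of the first
   atom and not that of the goal, in which the carrier may be seen through
   another structure. *)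
Ltac lin_atoms t l :=
  lazymatch t with
  | plus ?x ?y => let l := lin_atoms x l in lin_atoms y l
  | minus ?x ?y => let l := lin_atoms x l in lin_atoms y l
  | opp ?x => lin_atoms x l
  | scal _ ?x => lin_atoms x l
  | zero => l
  | _ => lazymatch lin_index t l with
         | Some _ => l
         | None => lazymatch l with
                   | tt => constr:(t :: nil)
                   | _ => constr:(t :: l)
                   end
         end
  end.

Ltac lin_reify t l :=
  lazymatch t with
  | plus ?x ?y =>
      let e := lin_reify x l in let f := lin_reify y l in constr:(LPlus e f)
  | minus ?x ?y =>
      let e := lin_reify x l in let f := lin_reify y l in constr:(LPlus e (LOpp f))
  | opp ?x => let e := lin_reify x l in constr:(LOpp e)
  | scal ?a ?x => let e := lin_reify x l in constr:(LScal a e)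
  | zero => constr:(LZero)
  | _ => lazymatch lin_index t l with Some ?i => constr:(LVar i) end
  end.

(** An identity between linear combinations holds once the coefficients of each
    vector agree; those that [field] does not settle are left as goals. *)
Ltac linear_identity :=
  cbv beta;
  lazymatch goal with
  | |- ?s = ?t =>
      let l := lin_atoms s tt in
      let l := lin_atoms t l in
      let e := lin_reify s l in
      let f := lin_reify t l in
      change (lin_eval l e = lin_eval l f);
      apply lin_eval_eq; cbn [coef_agree length lin_coef Nat.eqb];
      repeat split; try (field; repeat split; try lra)
  end.

(** * The underlying real Banach space *)

Section RealForm.
Variable X : CompleteNormedModule C_AbsRing.

Let rscal (a : R) (x : X) : X := scal (RtoC a : C_AbsRing) x.

Lemma rscal_assoc (a b : R) (x : X) : rscal a (rscal b x) = rscal (mult a b) x.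
Proof.
unfold rscal; rewrite scal_assoc; f_equal.
symmetry; apply RtoC_mult.
Qed.

Lemma rscal_one (x : X) : rscal one x = x.
Proof. exact (scal_one x). Qed.

Lemma rscal_distr_l (a : R) (x y : X) :
  rscal a (plus x y) = plus (rscal a x) (rscal a y).
Proof. exact (scal_distr_l (RtoC a : C_AbsRing) x y). Qed.

Lemma rscal_distr_r (a b : R) (x : X) :
  rscal (plus a b) x = plus (rscal a x) (rscal b x).
Proof.
etransitivity; [|exact (scal_distr_r (RtoC a : C_AbsRing) (RtoC b) x)].
unfold rscal; f_equal; apply RtoC_plus.
Qed.

Definition real_module_mixin :=
  ModuleSpace.Mixin R_AbsRing X rscal
    rscal_assoc rscal_one rscal_distr_l rscal_distr_r.

Definition real_module_class :=
  ModuleSpace.Class R_AbsRing X (NormedModule.class C_AbsRing X : AbelianGroup.class_of X)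
    real_module_mixin.

Definition real_aux_class :=
  NormedModuleAux.Class R_AbsRing X real_module_class
    (NormedModule.class C_AbsRing X : UniformSpace.mixin_of X).

Lemma rscal_norm (a : R) (x : X) : norm (rscal a x) <= abs a * norm x.
Proof.
eapply Rle_trans; [exact (norm_scal (RtoC a : C_AbsRing) x)|].
apply Req_le; f_equal; apply Cmod_R.
Qed.

Definition real_normed_mixin :=
  NormedModule.Mixin R_AbsRing (NormedModuleAux.Pack R_AbsRing X real_aux_class X)
    norm (@norm_factor C_AbsRing X) norm_triangle rscal_norm
    norm_compat1 norm_compat2 norm_eq_zero.

(** Restriction of scalars: the vectors, the norm and the uniform structure of
    [X] are kept, so real statements about [real_form] are statements about
    [X]. *)
Definition real_form : CompleteNormedModule R_AbsRing :=
  CompleteNormedModule.Pack R_AbsRing X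
    (CompleteNormedModule.Class R_AbsRing X
      (NormedModule.Class R_AbsRing X real_aux_class real_normed_mixin)
      (CompleteNormedModule.class C_AbsRing X : CompleteSpace.mixin_of X)) X.

End RealForm.

(** * A mean value inequality for one-sided derivatives *)

(** If [phi b] exceeded [phi 0], a line of positive slope starting at [phi 0]
    would end below [phi b]; but the last point up to which [phi] lies under
    that line can always be moved further right. *)
Lemma dini_nonincreasing (phi : R -> R) (b : R) :
  0 <= b ->
  (forall s, 0 < s <= b -> forall eps, 0 < eps -> exists delta, 0 < delta /\
     forall h, 0 < h < delta -> 0 <= s - h -> phi s <= phi (s - h) + eps) ->
  (forall s, 0 <= s < b -> forall eps, 0 < eps -> exists delta, 0 < delta /\
     forall h, 0 < h < delta -> phi (s + h) <= phi s + eps * h) ->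
  phi b <= phi 0.
Proof.
intros Hb Hleft Hright.
apply Rnot_lt_le; intros Hlt.
assert (Hb0 : 0 < b) by (destruct Hb as [Hb | <-]; [easy | lra]).
set (eps := (phi b - phi 0) / (2 * b)).
assert (Heps : 0 < eps) by (apply Rdiv_lt_0_compat; lra).
(* The slack [eps * s] turns the Dini condition into a strict one. *)
set (S s := 0 <= s <= b /\ phi s <= phi 0 + eps * s).
destruct (completeness S) as [c [Hub Hlub]].
{ exists b; intros s [Hs _]; lra. }
{ exists 0; split; lra. }
assert (Hc0 : 0 <= c) by (apply Hub; split; lra).
assert (Hcb : c <= b) by (apply Hlub; intros s [Hs _]; lra).
assert (HcS : phi c <= phi 0 + eps * c).
{ destruct Hc0 as [Hc0 | <-]; [|lra].
  apply le_epsilon; intros eta Heta.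
  destruct (Hleft c (conj Hc0 Hcb) eta Heta) as [delta [Hd Hc]].
  destruct (classic
    (exists s, S s /\ c - delta < s < c)) as [[s [[Hs Hphi] Hsc]] | Hno].
  - specialize (Hc (c - s)); replace (c - (c - s)) with s in Hc by ring.
    assert (eps * s <= eps * c) by (apply Rmult_le_compat_l; lra).
    lra.
  - apply Rnot_lt_le; intros Hnot.
    assert (c <= Rmax 0 (c - delta)).
    { apply Hlub; intros s Hs.
      assert (Hsc := Hub s Hs).
      destruct Hsc as [Hsc | ->].
      - apply Rnot_lt_le; intros Hm; apply Hno; exists s; split; [easy|].
        assert (H := Rmax_r 0 (c - delta)); lra.
      - destruct Hs as [_ Hs]; lra. }
    unfold Rmax in H; destruct Rle_dec; lra. }
destruct Hcb as [Hcb | ->].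
- destruct (Hright c (conj Hc0 Hcb) eps Heps) as [delta [Hd Hc]].
  set (h := Rmin (delta / 2) (b - c)).
  assert (Hh : 0 < h <= delta / 2 /\ h <= b - c).
  { unfold h; split; [split|].
    - apply Rmin_pos; lra.
    - apply Rmin_l.
    - apply Rmin_r. }
  assert (Hle : c + h <= c); [|lra].
  apply Hub; split; [lra|].
  assert (Hh2 : 0 < h < delta) by lra.
  specialize (Hc h Hh2); lra.
- assert (eps * b = (phi b - phi 0) / 2) by (unfold eps; field; lra).
  lra.
Qed.

Ltac rewrite_norm_as v :=
  lazymatch goal with |- norm ?x <= _ => replace x with v by linear_identity end.

Section RightDerivative.
Context {E : CompleteNormedModule R_AbsRing}.

Definition right_derivative (f : R -> E) (s : R) (l : E) : Prop :=
  forall eps, 0 < eps -> exists delta, 0 < delta /\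
    forall h, 0 < h < delta ->
      norm (minus (minus (f (s + h)) (f s)) (scal h l)) <= eps * h.

(** A right derivative on the half-line, plus the left continuity without
    which it would not control [f]. A semigroup is only meaningful at
    nonnegative times, so that its orbits have no two-sided derivative at 0. *)
Definition right_primitive (f f' : R -> E) : Prop :=
  (forall s, 0 <= s -> right_derivative f s (f' s)) /\
  (forall s, 0 < s -> forall eps, 0 < eps -> exists delta, 0 < delta /\
     forall h, 0 < h < delta -> 0 <= s - h -> norm (minus (f (s - h)) (f s)) <= eps).

Lemma norm_scal_le (a : R) (x : E) : norm (scal a x) <= Rabs a * norm x.
Proof. exact (norm_scal (a : R_AbsRing) x). Qed.

Lemma norm_scal_nonneg (a : R) (x : E) :
  0 <= a -> norm (scal a x) <= a * norm x.
Proof. intros Ha; rewrite <- (Rabs_pos_eq a Ha) at 2; apply norm_scal_le. Qed.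

Lemma norm_zero_vector : norm (zero : E) = 0.
Proof. exact norm_zero. Qed.

Lemma norm_le_zero_eq (x y : E) : norm (minus x y) <= 0 -> x = y.
Proof.
intros H.
assert (Hz : (minus x y : E) = zero).
{ refine (norm_eq_zero (minus x y) _).
  assert (G := norm_ge_0 (minus x y)); lra. }
transitivity (plus (minus x y) y : E); [linear_identity|].
rewrite Hz; linear_identity.
Qed.

Lemma norm_plus_le (x y : E) : norm (plus x y) <= norm x + norm y.
Proof. exact (norm_triangle x y). Qed.

Lemma norm_minus_le (x y : E) : norm (minus x y) <= norm x + norm y.
Proof. rewrite <- (norm_opp y); exact (norm_triangle x (opp y)). Qed.

Lemma right_mean_value (f f' : R -> E) (g g' : R -> R) (b : R) :
  right_primitive f f' ->
  (forall s, 0 <= s <= b -> is_derive g s (g' s)) ->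
  (forall s, 0 <= s <= b -> norm (f' s) <= g' s) ->
  0 <= b ->
  norm (minus (f b) (f 0)) <= g b - g 0.
Proof.
intros [Hder Hleft] Hg Hle Hb.
set (phi s := norm (minus (f s) (f 0)) - g s).
enough (Hphi : phi b <= phi 0).
{ unfold phi in Hphi; replace (minus (f 0) (f 0)) with (zero : E) in Hphi by linear_identity;
  rewrite norm_zero_vector in Hphi; lra. }
apply dini_nonincreasing; [easy| |].
- intros s Hs eps Heps.
  destruct (Hleft s (proj1 Hs) (eps / 2)) as [d1 [Hd1 H1]]; [lra|].
  assert (Hs' : 0 <= s <= b) by lra.
  assert (Hcont : continuity_pt g s)
    by (apply derivable_continuous_pt; exists (g' s);
        now apply is_derive_Reals, Hg).
  assert (He2 : 0 < eps / 2) by lra.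
  destruct (Hcont (eps / 2) He2) as [d2 [Hd2 H2]].
  exists (Rmin d1 d2); split; [now apply Rmin_pos|].
  intros h Hh Hsh.
  assert (Hh1 : 0 < h < d1) by (assert (H := Rmin_l d1 d2); lra).
  assert (Hh2 : h < d2) by (assert (H := Rmin_r d1 d2); lra).
  specialize (H1 h Hh1 Hsh).
  assert (Hball : Rabs (g (s - h) - g s) < eps / 2).
  { apply (H2 (s - h)); split.
    - split; [exact I|lra].
    - change (Rabs (s - h - s) < d2).
      replace (s - h - s) with (- h) by ring.
      rewrite Rabs_Ropp, Rabs_pos_eq; lra. }
  apply Rabs_def2 in Hball.
  unfold phi.
  assert (Htri : norm (minus (f s) (f 0)) <=
                 norm (minus (f (s - h)) (f 0)) + norm (minus (f (s - h)) (f s))).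
  { replace (minus (f s) (f 0)) with
      (minus (minus (f (s - h)) (f 0)) (minus (f (s - h)) (f s)))
      by linear_identity.
    apply norm_minus_le. }
  lra.
- intros s Hs eps Heps.
  destruct (Hder s (proj1 Hs) (eps / 2)) as [d1 [Hd1 H1]]; [lra|].
  assert (Hs' : 0 <= s <= b) by lra.
  assert (He2 : 0 < eps / 2) by lra.
  destruct (proj1 (is_derive_Reals _ _ _) (Hg s Hs') (eps / 2) He2) as [d2 H2].
  exists (Rmin d1 d2); split; [apply Rmin_pos; [easy|apply cond_pos]|].
  intros h Hh.
  assert (Hh1 : 0 < h < d1) by (assert (H := Rmin_l d1 d2); lra).
  assert (Hh2 : h < d2) by (assert (H := Rmin_r d1 d2); lra).
  specialize (H1 h Hh1).
  assert (Hg' : Rabs ((g (s + h) - g s) / h - g' s) < eps / 2).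
  { apply H2; [lra|]; rewrite Rabs_pos_eq; lra. }
  assert (Hgl : (g' s - eps / 2) * h <= g (s + h) - g s).
  { apply Rabs_def2 in Hg'.
    replace (g (s + h) - g s) with ((g (s + h) - g s) / h * h) by (field; lra).
    apply Rmult_le_compat_r; lra. }
  assert (Hfl : norm (scal h (f' s)) <= h * g' s).
  { eapply Rle_trans; [apply norm_scal_nonneg; lra|].
    apply Rmult_le_compat_l; [lra|auto]. }
  unfold phi.
  set (r := minus (minus (f (s + h)) (f s)) (scal h (f' s))) in *.
  assert (Htri : norm (minus (f (s + h)) (f 0)) <=
                 norm (minus (f s) (f 0)) + (norm (scal h (f' s)) + norm r)).
  { replace (minus (f (s + h)) (f 0)) with
      (plus (minus (f s) (f 0)) (plus (scal h (f' s)) r))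
      by (unfold r; linear_identity).
    eapply Rle_trans; [apply norm_plus_le|].
    apply Rplus_le_compat_l, norm_plus_le. }
  lra.
Qed.

Lemma right_primitive_zero (f f' : R -> E) (b : R) :
  right_primitive f f' -> (forall s, 0 <= s <= b -> f' s = zero) ->
  0 <= b -> f b = f 0.
Proof.
intros Hf H0 Hb; apply norm_le_zero_eq.
replace 0 with (0 - 0) at 2 by ring.
apply (right_mean_value f f' (fun _ => 0) (fun _ => 0)); auto.
- intros s _; apply (@is_derive_const R_AbsRing R_NormedModule).
- intros s Hs; rewrite (H0 s Hs), norm_zero_vector; lra.
Qed.

Lemma right_primitive_plus (f f' g g' : R -> E) :
  right_primitive f f' -> right_primitive g g' ->
  right_primitive (fun s => plus (f s) (g s)) (fun s => plus (f' s) (g' s)).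
Proof.
intros [Hf Cf] [Hg Cg]; split.
- intros s Hs eps Heps.
  destruct (Hf s Hs (eps / 2)) as [d1 [Hd1 H1]]; [lra|].
  destruct (Hg s Hs (eps / 2)) as [d2 [Hd2 H2]]; [lra|].
  exists (Rmin d1 d2); split; [now apply Rmin_pos|].
  intros h Hh.
  assert (G1 := Rmin_l d1 d2); assert (G2 := Rmin_r d1 d2).
  rewrite_norm_as (plus (minus (minus (f (s + h)) (f s)) (scal h (f' s)))
          (minus (minus (g (s + h)) (g s)) (scal h (g' s)))).
  eapply Rle_trans; [apply norm_plus_le|].
  specialize (H1 h); specialize (H2 h); lra.
- intros s Hs eps Heps.
  destruct (Cf s Hs (eps / 2)) as [d1 [Hd1 H1]]; [lra|].
  destruct (Cg s Hs (eps / 2)) as [d2 [Hd2 H2]]; [lra|].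
  exists (Rmin d1 d2); split; [now apply Rmin_pos|].
  intros h Hh Hsh.
  assert (G1 := Rmin_l d1 d2); assert (G2 := Rmin_r d1 d2).
  rewrite_norm_as (plus (minus (f (s - h)) (f s)) (minus (g (s - h)) (g s))).
  eapply Rle_trans; [apply norm_plus_le|].
  specialize (H1 h); specialize (H2 h); lra.
Qed.

Lemma right_primitive_shift (f f' : R -> E) (a : R) :
  0 <= a -> right_primitive f f' ->
  right_primitive (fun s => f (s + a)) (fun s => f' (s + a)).
Proof.
intros Ha [Hf Cf]; split.
- intros s Hs eps Heps.
  destruct (Hf (s + a)) with (2 := Heps) as [d [Hd H]]; [lra|].
  exists d; split; [easy|]; intros h Hh.
  replace (s + h + a) with (s + a + h) by ring; auto.
- intros s Hs eps Heps.
  destruct (Cf (s + a)) with (2 := Heps) as [d [Hd H]]; [lra|].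
  exists d; split; [easy|]; intros h Hh Hsh.
  replace (s - h + a) with (s + a - h) by ring; apply H; lra.
Qed.

Lemma right_primitive_linear (L : E -> E) (C : R) (f f' : R -> E) :
  (forall x y, L (minus x y) = minus (L x) (L y)) ->
  (forall a x, L (scal a x) = scal a (L x)) ->
  (forall x, norm (L x) <= C * norm x) ->
  right_primitive f f' ->
  right_primitive (fun s => L (f s)) (fun s => L (f' s)).
Proof.
intros Hm Hs HC [Hf Cf].
assert (HC' : forall x, norm (L x) <= (Rabs C + 1) * norm x).
{ intros x; eapply Rle_trans; [apply HC|].
  apply Rmult_le_compat_r; [apply norm_ge_0|].
  assert (H := Rle_abs C); lra. }
assert (Hpos : 0 < Rabs C + 1) by (assert (H := Rabs_pos C); lra).
split.
- intros s Hs0 eps Heps.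
  destruct (Hf s Hs0 (eps / (Rabs C + 1))) as [d [Hd H]];
    [now apply Rdiv_lt_0_compat|].
  exists d; split; [easy|]; intros h Hh.
  rewrite <- Hm, <- Hs, <- Hm.
  eapply Rle_trans; [apply HC'|].
  replace (eps * h) with ((Rabs C + 1) * (eps / (Rabs C + 1) * h)) by (field; lra).
  apply Rmult_le_compat_l; [lra|auto].
- intros s Hs0 eps Heps.
  destruct (Cf s Hs0 (eps / (Rabs C + 1))) as [d [Hd H]];
    [now apply Rdiv_lt_0_compat|].
  exists d; split; [easy|]; intros h Hh Hsh.
  rewrite <- Hm.
  eapply Rle_trans; [apply HC'|].
  replace eps with ((Rabs C + 1) * (eps / (Rabs C + 1))) by (field; lra).
  apply Rmult_le_compat_l; [lra|auto].
Qed.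

Lemma right_primitive_affine (c : E) :
  right_primitive (fun s => scal s c) (fun _ => c).
Proof.
split.
- intros s Hs eps Heps; exists 1; split; [lra|]; intros h Hh.
  rewrite_norm_as (zero : E).
  rewrite norm_zero_vector; apply Rmult_le_pos; lra.
- intros s Hs eps Heps.
  assert (Hpos : 0 < norm c + 1) by (assert (H := norm_ge_0 c); lra).
  exists (eps / (norm c + 1)); split; [now apply Rdiv_lt_0_compat|].
  intros h Hh _.
  rewrite_norm_as (scal (- h) c).
  eapply Rle_trans; [apply norm_scal_le|].
  rewrite Rabs_Ropp, Rabs_pos_eq by lra.
  replace eps with (eps / (norm c + 1) * (norm c + 1)) by (field; lra).
  apply Rmult_le_compat; [lra|apply norm_ge_0|lra|lra].
Qed.

End RightDerivative.

(** * Bounded semigroups and their generators *)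

Section Semigroup.
Context {E : CompleteNormedModule R_AbsRing}.

Record bounded_semigroup (T : R -> E -> E) (M : R) : Prop := {
  sg_plus : forall t x y, 0 <= t -> T t (plus x y) = plus (T t x) (T t y);
  sg_scal : forall t a x, 0 <= t -> T t (scal a x) = scal a (T t x);
  sg_zero : forall x, T 0 x = x;
  sg_add : forall s t x, 0 <= s -> 0 <= t -> T (s + t) x = T s (T t x);
  sg_bound : forall t x, 0 <= t -> norm (T t x) <= M * norm x;
  sg_bound_ge_0 : 0 <= M;
  sg_continuous : forall x eps, 0 < eps -> exists delta, 0 < delta /\
    forall h, 0 < h < delta -> norm (minus (T h x) x) <= eps
}.

(** The graph of [A], where [-A] generates [T]. A relation makes it possible to
    speak of [A v] without carrying the domain of [A]. *)
Definition neg_generator (T : R -> E -> E) (v w : E) : Prop :=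
  forall eps, 0 < eps -> exists delta, 0 < delta /\
    forall h, 0 < h < delta ->
      norm (plus (minus (T h v) v) (scal h w)) <= eps * h.

Lemma neg_generator_ext (T T' : R -> E -> E) (v w : E) :
  (forall h, T h v = T' h v) -> neg_generator T v w -> neg_generator T' v w.
Proof.
intros HT H eps Heps; destruct (H eps Heps) as [d [Hd Hh]].
exists d; split; [easy|]; intros h; rewrite <- HT; auto.
Qed.

(** The generator of this semigroup is [- (A + l)], and its orbits are
    integrable on the half-line when [l > 0]. *)
Definition dilate (l : R) (T : R -> E -> E) (s : R) (x : E) : E :=
  scal (exp (- l * s)) (T s x).

Lemma exp_first_order (l eps : R) :
  0 < eps -> exists delta, 0 < delta /\ forall h, 0 < h < delta ->
    Rabs (exp (l * h) - 1 - l * h) <= eps * h.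
Proof.
intros Heps.
assert (H : is_derive (fun h => exp (l * h)) 0 l).
{ auto_derive; [easy|]; rewrite Rmult_0_r, exp_0; ring. }
destruct (proj1 (is_derive_Reals _ _ _) H eps Heps) as [d Hd].
exists d; split; [apply cond_pos|]; intros h Hh.
specialize (Hd h); rewrite Rplus_0_l, Rmult_0_r, exp_0 in Hd.
assert (G : Rabs ((exp (l * h) - 1) / h - l) < eps).
{ apply Hd; [lra|]; rewrite Rabs_pos_eq; lra. }
replace (exp (l * h) - 1 - l * h) with (((exp (l * h) - 1) / h - l) * h)
  by (field; lra).
rewrite Rabs_mult, (Rabs_pos_eq h) by lra.
apply Rmult_le_compat_r; lra.
Qed.

Lemma neg_generator_dilate (T : R -> E -> E) (l : R) (v w : E) :
  neg_generator T v w -> neg_generator (dilate l T) v (plus w (scal l v)).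
Proof.
intros Hv eps Heps.
assert (Nv := norm_ge_0 v); assert (Nw := norm_ge_0 w).
set (eta := Rmin 1 (eps / (2 + norm v + norm w))).
assert (Heta : 0 < eta <= 1).
{ split; [|apply Rmin_l].
  apply Rmin_pos; [lra|apply Rdiv_lt_0_compat; lra]. }
assert (Heta' : eta * (2 + norm v + norm w) <= eps).
{ replace eps with (eps / (2 + norm v + norm w) * (2 + norm v + norm w))
    by (field; lra).
  apply Rmult_le_compat_r; [lra|apply Rmin_r]. }
assert (Hl := Rabs_pos l).
destruct (Hv eta (proj1 Heta)) as [d1 [Hd1 H1]].
destruct (exp_first_order (- l) eta (proj1 Heta)) as [d2 [Hd2 H2]].
set (d3 := eta / (eta + Rabs l)).
assert (Hd3 : 0 < d3) by (apply Rdiv_lt_0_compat; lra).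
exists (Rmin d1 (Rmin d2 d3)); split; [repeat apply Rmin_pos; easy|].
intros h Hh.
assert (G1 := Rmin_l d1 (Rmin d2 d3)); assert (G2 := Rmin_r d1 (Rmin d2 d3)).
assert (G3 := Rmin_l d2 d3); assert (G4 := Rmin_r d2 d3).
specialize (H1 h ltac:(lra)); specialize (H2 h ltac:(lra)).
assert (H3 : (eta + Rabs l) * h <= eta).
{ replace eta with ((eta + Rabs l) * d3) at 2 by (unfold d3; field; lra).
  apply Rmult_le_compat_l; lra. }
unfold dilate; set (e := exp (- l * h)) in *.
assert (He : Rabs (1 - e) <= eta).
{ replace (1 - e) with (- (e - 1 - - l * h) + l * h) by ring.
  eapply Rle_trans; [apply Rabs_triang|].
  rewrite Rabs_Ropp, Rabs_mult, (Rabs_pos_eq h) by lra.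
  rewrite Rmult_plus_distr_r in H3; lra. }
assert (He0 : 0 < e) by apply exp_pos.
assert (He2 : e <= 2) by (apply Rabs_le_between in He; lra).
rewrite_norm_as
  (plus (scal e (plus (minus (T h v) v) (scal h w)))
     (plus (scal (e - 1 - - l * h) v) (scal (h * (1 - e)) w))).
eapply Rle_trans; [apply norm_plus_le|].
eapply Rle_trans; [apply Rplus_le_compat_l, norm_plus_le|].
assert (I1 : norm (scal e (plus (minus (T h v) v) (scal h w))) <= 2 * (eta * h)).
{ eapply Rle_trans; [apply norm_scal_nonneg; lra|].
  apply Rmult_le_compat; try lra; apply norm_ge_0. }
assert (I2 : norm (scal (e - 1 - - l * h) v) <= eta * h * norm v).
{ eapply Rle_trans; [apply norm_scal_le|].
  now apply Rmult_le_compat_r. }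
assert (I3 : norm (scal (h * (1 - e)) w) <= h * eta * norm w).
{ eapply Rle_trans; [apply norm_scal_le|].
  apply Rmult_le_compat_r; [easy|].
  rewrite Rabs_mult, (Rabs_pos_eq h) by lra.
  apply Rmult_le_compat_l; lra. }
apply Rle_trans with (eta * (2 + norm v + norm w) * h); [lra|].
apply Rmult_le_compat_r; lra.
Qed.

Lemma neg_generator_undilate (T : R -> E -> E) (l : R) (v w : E) :
  neg_generator (dilate l T) v w -> neg_generator T v (minus w (scal l v)).
Proof.
intros H.
replace (minus w (scal l v)) with (plus w (scal (- l) v)) by linear_identity.
apply neg_generator_ext with (dilate (- l) (dilate l T)).
- intros h; unfold dilate.
  transitivity (scal (exp (- - l * h) * exp (- l * h)) (T h v) : E);
    [linear_identity|].
  rewrite <- exp_plus.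
  replace (- - l * h + - l * h) with 0 by ring.
  rewrite exp_0; linear_identity.
- now apply neg_generator_dilate.
Qed.

Lemma exp_decreasing_le_1 (l t : R) : 0 <= l -> 0 <= t -> exp (- l * t) <= 1.
Proof.
intros Hl Ht.
assert (Hlt : 0 <= l * t) by now apply Rmult_le_pos.
assert (H := exp_ineq1_le (l * t)).
rewrite Ropp_mult_distr_l_reverse, exp_Ropp, <- Rinv_1.
apply Rinv_le_contravar; lra.
Qed.

Lemma exp_decay (l C eps : R) :
  0 < l -> 0 <= C -> 0 < eps -> exists s, 0 <= s /\ exp (- l * s) * C <= eps.
Proof.
intros Hl HC Heps.
assert (HCe : 0 <= C / eps) by (apply Rdiv_le_0_compat; lra).
exists (C / eps / l); split; [apply Rdiv_le_0_compat; lra|].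
replace (- l * (C / eps / l)) with (- (C / eps)) by (field; lra).
rewrite exp_Ropp.
assert (H := exp_ineq1_le (C / eps)).
apply Rle_trans with (/ (1 + C / eps) * C).
- apply Rmult_le_compat_r; [easy|]; apply Rinv_le_contravar; lra.
- apply Rmult_le_reg_l with (1 + C / eps); [lra|].
  rewrite <- Rmult_assoc, Rinv_r, Rmult_1_l by lra.
  replace ((1 + C / eps) * eps) with (eps + C) by (field; lra); lra.
Qed.

Section Bounded.
Context {T : R -> E -> E} {M : R} (HT : bounded_semigroup T M).

Lemma sg_minus (t : R) (x y : E) :
  0 <= t -> T t (minus x y) = minus (T t x) (T t y).
Proof.
intros Ht.
replace (minus x y) with (plus x (scal (-1) y)) by linear_identity.
rewrite (sg_plus _ _ HT), (sg_scal _ _ HT) by easy; linear_identity.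
Qed.

Lemma dilate_bounded_semigroup (l : R) :
  0 <= l -> bounded_semigroup (dilate l T) M.
Proof.
intros Hl; unfold dilate; split.
- intros t x y Ht; rewrite (sg_plus _ _ HT) by easy; linear_identity.
- intros t a x Ht; rewrite (sg_scal _ _ HT) by easy; linear_identity.
- intros x; rewrite (sg_zero _ _ HT), Rmult_0_r, exp_0; linear_identity.
- intros s t x Hs Ht; rewrite (sg_add _ _ HT), (sg_scal _ _ HT) by easy.
  rewrite Rmult_plus_distr_l, exp_plus; linear_identity.
- intros t x Ht; eapply Rle_trans; [apply norm_scal_nonneg, Rlt_le, exp_pos|].
  rewrite <- (Rmult_1_l (M * norm x)).
  apply Rmult_le_compat.
  + apply Rlt_le, exp_pos.
  + apply norm_ge_0.
  + now apply exp_decreasing_le_1.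
  + now apply (sg_bound _ _ HT).
- exact (sg_bound_ge_0 _ _ HT).
- intros x eps Heps.
  destruct (sg_continuous _ _ HT x (eps / 2)) as [d1 [Hd1 H1]]; [lra|].
  assert (Nx := norm_ge_0 x).
  set (eta := eps / (2 * (norm x + 1) * (1 + l))).
  assert (Heta : 0 < eta)
    by (apply Rdiv_lt_0_compat; [lra|]; repeat apply Rmult_lt_0_compat; lra).
  destruct (exp_first_order (- l) 1) as [d2 [Hd2 H2]]; [lra|].
  exists (Rmin d1 (Rmin d2 eta)); split; [repeat apply Rmin_pos; easy|].
  intros h Hh.
  assert (G1 := Rmin_l d1 (Rmin d2 eta)).
  assert (G2 := Rmin_r d1 (Rmin d2 eta)).
  assert (G3 := Rmin_l d2 eta); assert (G4 := Rmin_r d2 eta).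
  specialize (H1 h ltac:(lra)); specialize (H2 h ltac:(lra)).
  set (e := exp (- l * h)) in *.
  assert (He : Rabs (e - 1) <= (1 + l) * h).
  { replace (e - 1) with ((e - 1 - - l * h) + - (l * h)) by ring.
    eapply Rle_trans; [apply Rabs_triang|].
    rewrite Rabs_Ropp, Rabs_mult, (Rabs_pos_eq h), (Rabs_pos_eq l) by lra.
    lra. }
  assert (He1 : e <= 1).
  { apply exp_decreasing_le_1; lra. }
  assert (He0 : 0 < e) by apply exp_pos.
  rewrite_norm_as (plus (scal e (minus (T h x) x)) (scal (e - 1) x)).
  eapply Rle_trans; [apply norm_plus_le|].
  assert (I1 : norm (scal e (minus (T h x) x)) <= 1 * (eps / 2)).
  { eapply Rle_trans; [apply norm_scal_nonneg; lra|].
    apply Rmult_le_compat; try lra; apply norm_ge_0. }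
  assert (I2 : norm (scal (e - 1) x) <= (1 + l) * eta * (norm x + 1)).
  { eapply Rle_trans; [apply norm_scal_le|].
    apply Rmult_le_compat; try lra; [apply Rabs_pos|].
    eapply Rle_trans; [apply He|]; apply Rmult_le_compat_l; lra. }
  replace ((1 + l) * eta * (norm x + 1)) with (eps / 2) in I2
    by (unfold eta; field; lra).
  lra.
Qed.

(** [T t x - T s x] is [T s (T (t - s) x - x)], and [T s] is bounded by [M]. *)
Lemma sg_uniformly_continuous (x : E) (eps : R) :
  0 < eps -> exists delta, 0 < delta /\
    forall s t, 0 <= s -> 0 <= t -> Rabs (t - s) < delta ->
      norm (minus (T t x) (T s x)) <= eps.
Proof.
intros Heps; assert (HM := sg_bound_ge_0 _ _ HT).
destruct (sg_continuous _ _ HT x (eps / (M + 1))) as [d [Hd H]];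
  [apply Rdiv_lt_0_compat; lra|].
exists d; split; [easy|].
assert (Hst : forall s t, 0 <= s < t -> t - s < d ->
              norm (minus (T t x) (T s x)) <= eps).
{ intros s t Hs Ht.
  replace t with (s + (t - s)) by ring.
  rewrite (sg_add _ _ HT), <- sg_minus by lra.
  eapply Rle_trans; [apply (sg_bound _ _ HT); lra|].
  replace eps with ((M + 1) * (eps / (M + 1))) by (field; lra).
  apply Rmult_le_compat; [lra|apply norm_ge_0|lra|apply H; lra]. }
intros s t Hs Ht Hd'; apply Rabs_def2 in Hd'.
destruct (Rtotal_order s t) as [Hlt | [<- | Hlt]].
- apply Hst; lra.
- rewrite_norm_as (zero : E); rewrite norm_zero_vector; lra.
- rewrite_norm_as (scal (-1) (minus (T s x) (T t x))).
  eapply Rle_trans; [apply norm_scal_le|].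
  rewrite Rabs_m1, Rmult_1_l; apply Hst; lra.
Qed.

Lemma neg_generator_plus (v w v' w' : E) :
  neg_generator T v w -> neg_generator T v' w' ->
  neg_generator T (plus v v') (plus w w').
Proof.
intros H H' eps Heps.
destruct (H (eps / 2)) as [d [Hd Hh]]; [lra|].
destruct (H' (eps / 2)) as [d' [Hd' Hh']]; [lra|].
exists (Rmin d d'); split; [now apply Rmin_pos|]; intros h Hm.
assert (G1 := Rmin_l d d'); assert (G2 := Rmin_r d d').
rewrite (sg_plus _ _ HT) by lra.
rewrite_norm_as (plus (plus (minus (T h v) v) (scal h w))
                      (plus (minus (T h v') v') (scal h w'))).
eapply Rle_trans; [apply norm_plus_le|].
specialize (Hh h); specialize (Hh' h); lra.
Qed.

Lemma neg_generator_bounded_map (L : E -> E) (C : R) (v w : E) :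
  (forall h, 0 <= h -> L (T h v) = T h (L v)) ->
  (forall x y, L (plus x y) = plus (L x) (L y)) ->
  (forall a x, L (scal a x) = scal a (L x)) ->
  (forall x, norm (L x) <= C * norm x) ->
  neg_generator T v w -> neg_generator T (L v) (L w).
Proof.
intros Hc Hp Hs HC H eps Heps.
assert (HC0 := Rabs_pos C).
destruct (H (eps / (Rabs C + 1))) as [d [Hd Hh]];
  [apply Rdiv_lt_0_compat; lra|].
exists d; split; [easy|]; intros h Hm; specialize (Hh h Hm).
rewrite <- Hc by lra.
replace (plus (minus (L (T h v)) (L v)) (scal h (L w)))
  with (L (plus (minus (T h v) v) (scal h w))).
- eapply Rle_trans; [apply HC|].
  replace (eps * h) with ((Rabs C + 1) * (eps / (Rabs C + 1) * h))
    by (field; lra).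
  eapply Rle_trans; [apply Rmult_le_compat_r; [apply norm_ge_0|]|].
  + apply Rle_trans with (2 := Rlt_le _ _ (Rlt_plus_1 (Rabs C))), Rle_abs.
  + apply Rmult_le_compat_l; lra.
- rewrite Hp, Hs.
  replace (minus (T h v) v) with (plus (T h v) (scal (-1) v)) by linear_identity.
  rewrite Hp, Hs; linear_identity.
Qed.

Lemma neg_generator_scal (a : R) (v w : E) :
  neg_generator T v w -> neg_generator T (scal a v) (scal a w).
Proof.
apply (neg_generator_bounded_map (fun x => scal a x) (Rabs a)).
- intros h Hh; now rewrite (sg_scal _ _ HT).
- intros x y; linear_identity.
- intros b x; linear_identity.
- intros x; apply norm_scal_le.
Qed.

Lemma neg_generator_minus (v w v' w' : E) :
  neg_generator T v w -> neg_generator T v' w' ->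
  neg_generator T (minus v v') (minus w w').
Proof.
intros H H'.
replace (minus v v') with (plus v (scal (-1) v')) by linear_identity.
replace (minus w w') with (plus w (scal (-1) w')) by linear_identity.
now apply neg_generator_plus, neg_generator_scal.
Qed.

Lemma neg_generator_orbit (t : R) (v w : E) :
  0 <= t -> neg_generator T v w -> neg_generator T (T t v) (T t w).
Proof.
intros Ht; apply (neg_generator_bounded_map (T t) M).
- intros h Hh; rewrite <- !(sg_add _ _ HT) by easy; f_equal; ring.
- intros x y; now apply (sg_plus _ _ HT).
- intros a x; now apply (sg_scal _ _ HT).
- intros x; now apply (sg_bound _ _ HT).
Qed.

Lemma neg_generator_unique (v w w' : E) :
  neg_generator T v w -> neg_generator T v w' -> w = w'.
Proof.
intros H H'; apply norm_le_zero_eq, le_epsilon; intros eps Heps.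
destruct (H (eps / 2)) as [d [Hd Hh]]; [lra|].
destruct (H' (eps / 2)) as [d' [Hd' Hh']]; [lra|].
assert (Hmin := Rmin_pos _ _ Hd Hd').
assert (G1 := Rmin_l d d'); assert (G2 := Rmin_r d d').
set (h := Rmin d d' / 2) in *.
specialize (Hh h ltac:(unfold h; lra)); specialize (Hh' h ltac:(unfold h; lra)).
assert (Hh0 : 0 < h) by (unfold h; lra).
rewrite_norm_as (scal (/ h) (minus (plus (minus (T h v) v) (scal h w))
                                   (plus (minus (T h v) v) (scal h w')))).
eapply Rle_trans; [apply norm_scal_nonneg, Rlt_le, Rinv_0_lt_compat; lra|].
replace (0 + eps) with (/ h * (eps / 2 * h + eps / 2 * h)) by (field; lra).
apply Rmult_le_compat_l; [apply Rlt_le, Rinv_0_lt_compat; lra|].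
eapply Rle_trans; [apply norm_minus_le|]; lra.
Qed.

Lemma orbit_right_primitive (v w : E) :
  neg_generator T v w ->
  right_primitive (fun s => T s v) (fun s => scal (-1) (T s w)).
Proof.
intros H; assert (HM := sg_bound_ge_0 _ _ HT); split.
- intros s Hs eps Heps.
  destruct (H (eps / (M + 1))) as [d [Hd Hh]]; [apply Rdiv_lt_0_compat; lra|].
  exists d; split; [easy|]; intros h Hm; specialize (Hh h Hm).
  replace (minus (minus (T (s + h) v) (T s v)) (scal h (scal (-1) (T s w))))
    with (T s (plus (minus (T h v) v) (scal h w))).
  + eapply Rle_trans; [apply (sg_bound _ _ HT); easy|].
    replace (eps * h) with ((M + 1) * (eps / (M + 1) * h)) by (field; lra).
    apply Rmult_le_compat; try lra; apply norm_ge_0.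
  + rewrite (sg_plus _ _ HT), sg_minus, (sg_scal _ _ HT), (sg_add _ _ HT) by lra.
    linear_identity.
- intros s Hs eps Heps.
  destruct (sg_uniformly_continuous v eps Heps) as [d [Hd Hh]].
  exists d; split; [easy|]; intros h Hm Hsh; apply Hh; [lra|easy|].
  replace (s - h - s) with (- h) by ring; rewrite Rabs_Ropp, Rabs_pos_eq; lra.
Qed.

(** * Integrals of orbits *)

Lemma orbit_integral (x : E) :
  exists F : R -> E, F 0 = zero /\ right_primitive F (fun s => T s x).
Proof.
set (f s := T (Rmax 0 s) x).
assert (Hcont : forall s, continuous f s).
{ intros s; apply filterlim_locally; intros eps.
  assert (He : 0 < eps / 2) by (assert (H := cond_pos eps); lra).
  destruct (sg_uniformly_continuous x _ He) as [d [Hd H]].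
  exists (mkposreal d Hd); intros t Ht.
  refine (norm_compat1 (f s) (f t) eps _).
  apply Rle_lt_trans with (eps / 2);
    [|assert (G := cond_pos eps); lra].
  apply H; try apply Rmax_l.
  change (Rabs (t - s) < d) in Ht.
  apply Rle_lt_trans with (2 := Ht).
  unfold Rmax, Rabs; repeat destruct Rle_dec; repeat destruct Rcase_abs; lra. }
assert (Hint : forall a b, ex_RInt f a b)
  by (intros a b; apply ex_RInt_continuous; auto).
exists (fun s => RInt f 0 s); split; [apply RInt_point|].
assert (Hdiff : forall a b, (minus (RInt f 0 b) (RInt f 0 a) : E) = RInt f a b).
{ intros a b; rewrite <- (RInt_Chasles f 0 a b) by apply Hint.
  linear_identity. }
split.
- intros s Hs eps Heps.
  destruct (sg_uniformly_continuous x eps Heps) as [d [Hd H]].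
  exists d; split; [easy|]; intros h Hh.
  rewrite Hdiff.
  replace (eps * h) with ((s + h - s) * eps) by ring.
  apply (norm_RInt_le_const (fun u => minus (f u) (T s x)) s (s + h)); [lra| |].
  + intros u Hu; unfold f; rewrite Rmax_right by lra.
    apply H; [easy|lra|]; rewrite Rabs_pos_eq; lra.
  + replace h with (s + h - s) at 3 by ring.
    apply (is_RInt_minus f (fun _ => T s x)); [apply RInt_correct, Hint|].
    apply (is_RInt_const s (s + h) (T s x)).
- intros s Hs eps Heps.
  assert (Hx : 0 <= M * norm x)
    by (apply Rmult_le_pos; [apply (sg_bound_ge_0 _ _ HT)|apply norm_ge_0]).
  exists (eps / (M * norm x + 1)); split; [apply Rdiv_lt_0_compat; lra|].
  intros h Hh Hsh.
  rewrite_norm_as (scal (-1) (minus (RInt f 0 s) (RInt f 0 (s - h)))).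
  rewrite Hdiff; eapply Rle_trans; [apply norm_scal_le|].
  rewrite Rabs_m1, Rmult_1_l.
  apply Rle_trans with ((s - (s - h)) * (M * norm x)).
  + apply (norm_RInt_le_const f); [lra| |apply RInt_correct, Hint].
    intros u Hu; apply (sg_bound _ _ HT), Rmax_l.
  + replace (s - (s - h)) with h by ring.
    replace eps with (eps / (M * norm x + 1) * (M * norm x + 1)) by (field; lra).
    apply Rmult_le_compat; lra.
Qed.

End Bounded.

Section Orbits.
Context {T : R -> E -> E} {M : R} (HT : bounded_semigroup T M).

Section Integral.
Context {x : E} {F : R -> E} (F0 : F 0 = zero)
        (HF : right_primitive F (fun s => T s x)).

Lemma orbit_integral_add (s h : R) :
  0 <= s -> 0 <= h -> F (s + h) = plus (F h) (T h (F s)).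
Proof.
intros Hs Hh.
set (f s := plus (F (s + h)) (scal (-1) (T h (F s)))).
assert (Hf : f s = f 0).
{ apply right_primitive_zero
    with (fun s => plus (T (s + h) x) (scal (-1) (T h (T s x)))); [| |easy].
  - apply (right_primitive_plus (fun s => F (s + h)) (fun s => T (s + h) x)).
    { now apply (right_primitive_shift F (fun s => T s x)). }
    apply (right_primitive_linear (fun y => scal (-1) (T h y)) M F
             (fun s => T s x)); [| | |easy].
    + intros y z; rewrite (sg_minus HT) by easy; linear_identity.
    + intros a y; rewrite (sg_scal _ _ HT) by easy; linear_identity.
    + intros y; eapply Rle_trans; [apply norm_scal_le|].
      rewrite Rabs_m1, Rmult_1_l; now apply (sg_bound _ _ HT).
  - intros u Hu; rewrite Rplus_comm, (sg_add _ _ HT) by lra; linear_identity. }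
unfold f in Hf; rewrite F0, Rplus_0_l in Hf.
assert (Hz : T h (zero : E) = zero).
{ transitivity (T h (scal 0 x)); [f_equal; linear_identity|].
  rewrite (sg_scal _ _ HT) by easy; linear_identity. }
rewrite Hz in Hf.
transitivity (plus (plus (F (s + h)) (scal (-1) (T h (F s)))) (T h (F s)) : E);
  [linear_identity|].
rewrite Hf; linear_identity.
Qed.

Lemma orbit_integral_neg_generator (s : R) :
  0 <= s -> neg_generator T (F s) (minus x (T s x)).
Proof.
intros Hs eps Heps; destruct HF as [Hder _].
destruct (Hder s Hs (eps / 2)) as [d1 [Hd1 H1]]; [lra|].
destruct (Hder 0 (Rle_refl 0) (eps / 2)) as [d2 [Hd2 H2]]; [lra|].
exists (Rmin d1 d2); split; [now apply Rmin_pos|]; intros h Hh.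
assert (G1 := Rmin_l d1 d2); assert (G2 := Rmin_r d1 d2).
specialize (H1 h ltac:(lra)); specialize (H2 h ltac:(lra)).
rewrite F0, Rplus_0_l, (sg_zero _ _ HT) in H2.
rewrite (orbit_integral_add s h) in H1 by lra.
rewrite_norm_as
  (minus (minus (minus (plus (F h) (T h (F s))) (F s)) (scal h (T s x)))
         (minus (minus (F h) (zero : E)) (scal h x))).
eapply Rle_trans; [apply norm_minus_le|]; lra.
Qed.

End Integral.

(** The vector [T s v - v] is the integral of [- T u w] over [0, s]. *)
Lemma orbit_increment_le (v w : E) (g g' : R -> R) (s : R) :
  neg_generator T v w ->
  (forall u, 0 <= u <= s -> is_derive g u (g' u)) ->
  (forall u, 0 <= u <= s -> norm (T u w) <= g' u) ->
  0 <= s -> norm (minus (T s v) v) <= g s - g 0.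
Proof.
intros Hv Hg Hle Hs.
rewrite <- (sg_zero _ _ HT v) at 2.
apply (right_mean_value (fun u => T u v) (fun u => scal (-1) (T u w)) g g');
  try easy.
- now apply (orbit_right_primitive HT).
- intros u Hu; eapply Rle_trans; [apply norm_scal_le|].
  rewrite Rabs_m1, Rmult_1_l; auto.
Qed.

End Orbits.

(** * Orbit bounds and resolvents *)

Section Resolvent.
Context {T : R -> E -> E} {M : R} (HT : bounded_semigroup T M).

(** The least such [K] is an equivalent norm of [x], for which [T] and the
    resolvents [(1 + h A)^-1] are contractions. *)
Definition orbit_bound (x : E) (K : R) : Prop :=
  forall t, 0 <= t -> norm (T t x) <= K.

Lemma orbit_bound_of_norm (x : E) : orbit_bound x (M * norm x).
Proof. intros t Ht; now apply (sg_bound _ _ HT). Qed.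

Lemma norm_le_orbit_bound (x : E) (K : R) : orbit_bound x K -> norm x <= K.
Proof. intros H; rewrite <- (sg_zero _ _ HT x); apply H, Rle_refl. Qed.

Lemma orbit_bound_ge_0 (x : E) (K : R) : orbit_bound x K -> 0 <= K.
Proof.
intros H; apply Rle_trans with (norm x); [apply norm_ge_0|].
now apply norm_le_orbit_bound.
Qed.

Lemma orbit_bound_plus (x y : E) (K L : R) :
  orbit_bound x K -> orbit_bound y L -> orbit_bound (plus x y) (K + L).
Proof.
intros Hx Hy t Ht; rewrite (sg_plus _ _ HT) by easy.
eapply Rle_trans; [apply norm_plus_le|]; apply Rplus_le_compat; auto.
Qed.

Lemma orbit_bound_minus (x y : E) (K L : R) :
  orbit_bound x K -> orbit_bound y L -> orbit_bound (minus x y) (K + L).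
Proof.
intros Hx Hy t Ht; rewrite (sg_minus HT) by easy.
eapply Rle_trans; [apply norm_minus_le|]; apply Rplus_le_compat; auto.
Qed.

Lemma orbit_bound_scal (a : R) (x : E) (K : R) :
  0 <= a -> orbit_bound x K -> orbit_bound (scal a x) (a * K).
Proof.
intros Ha Hx t Ht; rewrite (sg_scal _ _ HT) by easy.
eapply Rle_trans; [now apply norm_scal_nonneg|].
apply Rmult_le_compat_l; auto.
Qed.

Lemma orbit_bound_orbit (s : R) (x : E) (K : R) :
  0 <= s -> orbit_bound x K -> orbit_bound (T s x) K.
Proof.
intros Hs Hx t Ht; rewrite <- (sg_add _ _ HT) by easy; apply Hx; lra.
Qed.

Lemma orbit_bound_increment (v w : E) (K s : R) :
  neg_generator T v w -> orbit_bound w K -> 0 <= s ->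
  orbit_bound (minus (T s v) v) (s * K).
Proof.
intros Hv Hw Hs t Ht.
rewrite (sg_minus HT), <- (sg_add _ _ HT), Rplus_comm, (sg_add _ _ HT) by easy.
replace (s * K) with (s * K - 0 * K) by ring.
apply (orbit_increment_le HT (T t v) (T t w) (fun u => u * K) (fun _ => K)); try easy.
- now apply (neg_generator_orbit HT).
- intros u _; auto_derive; [easy|ring].
- intros u Hu; now apply orbit_bound_orbit.
Qed.

(** The dilated orbit of [v] decreases from [v] to 0 at a speed bounded by
    [exp (- s / h) * (K / h)], which integrates to [K]. *)
Lemma resolvent_contraction (h : R) (v w : E) (K : R) :
  0 < h -> neg_generator T v w -> orbit_bound (plus v (scal h w)) K ->
  orbit_bound v K.
Proof.
intros Hh.
assert (Hl : 0 < / h) by now apply Rinv_0_lt_compat.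
enough (Hnorm : forall v w, neg_generator T v w ->
          orbit_bound (plus v (scal h w)) K -> norm v <= K).
{ intros Hv HK t Ht; apply (Hnorm (T t v) (T t w)).
  - now apply (neg_generator_orbit HT).
  - rewrite <- (sg_scal _ _ HT), <- (sg_plus _ _ HT) by easy.
    now apply orbit_bound_orbit. }
clear v w; intros v w Hv HK.
assert (K0 := orbit_bound_ge_0 _ _ HK).
apply le_epsilon; intros eps Heps.
assert (HC : 0 <= M * norm v)
  by (apply Rmult_le_pos; [apply (sg_bound_ge_0 _ _ HT)|apply norm_ge_0]).
destruct (exp_decay (/ h) (M * norm v) eps Hl HC Heps) as [s [Hs Hexp]].
assert (HS : bounded_semigroup (dilate (/ h) T) M)
  by (apply dilate_bounded_semigroup; [easy|lra]).
set (g u := - K * exp (- / h * u)).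
assert (Hinc : norm (minus (dilate (/ h) T s v) v) <= g s - g 0).
{ apply (orbit_increment_le HS v (plus w (scal (/ h) v)) g
           (fun u => exp (- / h * u) * (/ h * K))); [| | |easy].
  - now apply neg_generator_dilate.
  - intros u _; unfold g; auto_derive; [easy|ring].
  - intros u Hu; unfold dilate.
    eapply Rle_trans; [apply norm_scal_nonneg, Rlt_le, exp_pos|].
    apply Rmult_le_compat_l; [apply Rlt_le, exp_pos|].
    replace (plus w (scal (/ h) v)) with (scal (/ h) (plus v (scal h w)))
      by linear_identity.
    rewrite (sg_scal _ _ HT) by easy.
    eapply Rle_trans; [apply norm_scal_nonneg; lra|].
    apply Rmult_le_compat_l; [lra|now apply HK]. }
assert (Htail : norm (dilate (/ h) T s v) <= eps).
{ unfold dilate.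
  eapply Rle_trans; [apply norm_scal_nonneg, Rlt_le, exp_pos|].
  apply Rle_trans with (2 := Hexp).
  apply Rmult_le_compat_l; [apply Rlt_le, exp_pos|now apply (sg_bound _ _ HT)]. }
assert (Hg : g s - g 0 <= K).
{ unfold g; rewrite Rmult_0_r, exp_0.
  assert (H := Rmult_le_pos _ _ K0 (Rlt_le _ _ (exp_pos (- / h * s)))); lra. }
rewrite_norm_as (minus (dilate (/ h) T s v) (minus (dilate (/ h) T s v) v)).
eapply Rle_trans; [apply norm_minus_le|]; lra.
Qed.

Lemma neg_generator_resolvent_unique (h : R) (v w v' w' : E) :
  0 < h -> neg_generator T v w -> neg_generator T v' w' ->
  plus v (scal h w) = plus v' (scal h w') -> v = v'.
Proof.
intros Hh Hv Hv' Heq; apply norm_le_zero_eq, norm_le_orbit_bound.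
apply resolvent_contraction with h (minus w w'); [easy| |].
- now apply (neg_generator_minus HT).
- assert (Hz : forall a b : E, a = b -> minus a b = scal 0 v)
    by (intros a b ->; linear_identity).
  rewrite <- (Rmult_0_l (M * norm v)).
  match goal with |- orbit_bound ?x _ => replace x with (scal 0 v)
    by (rewrite <- (Hz _ _ Heq); linear_identity) end.
  apply orbit_bound_scal; [lra|apply orbit_bound_of_norm].
Qed.

(** The resolvent is the Laplace transform of the semigroup. *)
Lemma neg_generator_resolvent_exists (h : R) (x : E) :
  0 < h -> exists v w, neg_generator T v w /\ plus v (scal h w) = x.
Proof.
intros Hh.
assert (Hl : 0 < / h) by now apply Rinv_0_lt_compat.
assert (HS : bounded_semigroup (dilate (/ h) T) M)
  by (apply dilate_bounded_semigroup; [easy|lra]).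
set (S := dilate (/ h) T) in *.
destruct (orbit_integral HS x) as [F [F0 HF]].
set (C := M * norm x * h).
assert (HM := sg_bound_ge_0 _ _ HT).
assert (HMx : 0 <= M * norm x) by (apply Rmult_le_pos; [easy|apply norm_ge_0]).
assert (HC : 0 <= C) by (apply Rmult_le_pos; lra).
assert (Hdecay : forall s y, 0 <= s -> norm (S s y) <= exp (- / h * s) * (M * norm y)).
{ intros s y Hs; unfold S, dilate.
  eapply Rle_trans; [apply norm_scal_nonneg, Rlt_le, exp_pos|].
  apply Rmult_le_compat_l; [apply Rlt_le, exp_pos|now apply (sg_bound _ _ HT)]. }
assert (HFC : forall s, 0 <= s -> norm (F s) <= C).
{ intros s Hs.
  set (g u := - C * exp (- / h * u)).
  apply Rle_trans with (g s - g 0).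
  - rewrite_norm_as (minus (F s) (zero : E)); rewrite <- F0.
    apply (right_mean_value F (fun u => S u x) g
             (fun u => exp (- / h * u) * (M * norm x))); try easy.
    + intros u _; unfold g, C; auto_derive; [easy|field; lra].
    + intros u Hu; now apply Hdecay.
  - unfold g; rewrite Rmult_0_r, exp_0.
    assert (H := Rmult_le_pos _ _ HC (Rlt_le _ _ (exp_pos (- / h * s)))); lra. }
assert (Hadd := orbit_integral_add HS F0 HF).
(* The integral of the dilated orbit over the half-line converges because its
   tails decay exponentially. *)
assert (Hlim : exists y, filterlim F (Rbar_locally p_infty) (locally y)).
{ refine (proj1 (@filterlim_locally_cauchy R E (Rbar_locally p_infty) _ F) _).
  intros eps.
  assert (He : 0 < eps / 2) by (assert (G := cond_pos eps); lra).
  destruct (exp_decay (/ h) (M * C) (eps / 2)) as [s0 [Hs0 Hexp]];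
    [easy|now apply Rmult_le_pos|easy|].
  exists (fun s => s0 < s); split; [now exists s0|].
  assert (Hle : forall s t, s0 < s <= t -> norm (minus (F t) (F s)) <= eps / 2).
  { intros s t Hst.
    replace t with (t - s + s) by ring.
    rewrite Hadd by lra.
    rewrite_norm_as (S s (F (t - s))).
    eapply Rle_trans; [apply Hdecay; lra|].
    apply Rle_trans with (2 := Hexp).
    apply Rmult_le_compat; [apply Rlt_le, exp_pos| | |].
    - apply Rmult_le_pos; [easy|apply norm_ge_0].
    - assert (H : / h * s0 <= / h * s) by (apply Rmult_le_compat_l; lra).
      destruct H as [H|H]; [apply Rlt_le, exp_increasing|right; f_equal]; lra.
    - apply Rmult_le_compat_l; [easy|apply HFC; lra]. }
  intros s t Hs Ht.
  destruct (Rle_or_lt s t) as [Hst|Hst].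
  - refine (norm_compat1 (F s) (F t) eps _).
    apply Rle_lt_trans with (eps / 2); [apply Hle; lra|lra].
  - apply ball_sym; refine (norm_compat1 (F t) (F s) eps _).
    apply Rle_lt_trans with (eps / 2); [apply Hle; lra|lra]. }
destruct Hlim as [y Hy].
assert (Hlim : forall eps, 0 < eps -> exists s0, forall s, s0 < s ->
                 norm (minus (F s) y) <= eps).
{ intros eps Heps.
  assert (Hf := @norm_factor_gt_0 R_AbsRing E).
  assert (He : 0 < eps / @norm_factor R_AbsRing E) by now apply Rdiv_lt_0_compat.
  destruct (proj1 (filterlim_locally F y) Hy (mkposreal _ He)) as [s0 H].
  exists s0; intros s Hs; left.
  replace eps with (@norm_factor R_AbsRing E * (eps / @norm_factor R_AbsRing E))
    by (field; lra).
  exact (norm_compat2 y (F s) (mkposreal _ He) (H s Hs)). }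
assert (Hfix : forall s, 0 <= s -> y = plus (F s) (S s y)).
{ intros s Hs; apply norm_le_zero_eq, le_epsilon; intros eps Heps.
  destruct (Hlim (eps / (M + 1))) as [s0 H0]; [apply Rdiv_lt_0_compat; lra|].
  set (u := Rmax 0 s0 + 1).
  assert (Hu : 0 < u /\ s0 < u).
  { unfold u; assert (H := Rmax_l 0 s0); assert (H' := Rmax_r 0 s0); lra. }
  assert (H1 := H0 u ltac:(lra)); assert (H2 := H0 (u + s) ltac:(lra)).
  rewrite Hadd in H2 by lra.
  rewrite_norm_as (minus (minus (S s (F u)) (S s y))
                         (minus (plus (F s) (S s (F u))) y)).
  eapply Rle_trans; [apply norm_minus_le|].
  rewrite <- (sg_minus HS) by easy.
  replace (0 + eps) with (M * (eps / (M + 1)) + eps / (M + 1)) by (field; lra).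
  apply Rplus_le_compat; [|easy].
  eapply Rle_trans; [now apply (sg_bound _ _ HS)|].
  now apply Rmult_le_compat_l. }
assert (Hgen : neg_generator S y x).
{ intros eps Heps; destruct HF as [Hder _].
  destruct (Hder 0 (Rle_refl 0) eps Heps) as [d [Hd H]].
  exists d; split; [easy|]; intros s Hs; specialize (H s Hs).
  rewrite F0, Rplus_0_l, (sg_zero _ _ HS) in H.
  replace (minus (S s y) y) with (minus (S s y) (plus (F s) (S s y)))
    by (now rewrite <- Hfix by lra).
  rewrite_norm_as (scal (-1) (minus (minus (F s) (zero : E)) (scal s x))).
  eapply Rle_trans; [apply norm_scal_le|].
  now rewrite Rabs_m1, Rmult_1_l. }
exists (scal (/ h) y), (scal (/ h) (minus x (scal (/ h) y))); split.
- now apply (neg_generator_scal HT), neg_generator_undilate.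
- linear_identity.
Qed.
End Resolvent.
End Semigroup.

Arguments orbit_bound {E} T x K.

(** * Error of the implicit Euler scheme *)

Section Euler.
Context {E : CompleteNormedModule R_AbsRing}.
Context {T : R -> E -> E} {M : R} (HT : bounded_semigroup T M).
Context {h : R} (Hh : 0 < h) {J : E -> E}.
(* [J] is [(1 + h A)^-1]. *)
Context (HJ : forall x, neg_generator T (J x) (scal (/ h) (minus x (J x)))).

Lemma resolvent_eq (v w x : E) :
  neg_generator T v w -> plus v (scal h w) = x -> J x = v.
Proof.
intros Hv Hx.
apply (neg_generator_resolvent_unique HT h _ _ _ _ Hh (HJ x) Hv).
rewrite Hx; linear_identity.
Qed.

Lemma resolvent_plus (x y : E) : J (plus x y) = plus (J x) (J y).
Proof.
apply resolvent_eq with (1 := neg_generator_plus HT _ _ _ _ (HJ x) (HJ y)).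
linear_identity.
Qed.

Lemma resolvent_scal (a : R) (x : E) : J (scal a x) = scal a (J x).
Proof.
apply resolvent_eq with (1 := neg_generator_scal HT a _ _ (HJ x)).
linear_identity.
Qed.

Lemma orbit_bound_resolvent (x : E) (K : R) :
  orbit_bound T x K -> orbit_bound T (J x) K.
Proof.
intros Hx; apply (resolvent_contraction HT h) with (2 := HJ x); [easy|].
match goal with |- orbit_bound _ ?y _ => replace y with x by linear_identity end.
easy.
Qed.

Definition euler_defect (n : nat) (x : E) : E :=
  minus (Nat.iter n J x) (T (INR n * h) x).

Lemma INR_mult_ge_0 (n : nat) : 0 <= INR n * h.
Proof. apply Rmult_le_pos; [apply pos_INR|lra]. Qed.

Lemma euler_defect_plus (n : nat) (x y : E) :
  euler_defect n (plus x y) = plus (euler_defect n x) (euler_defect n y).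
Proof.
unfold euler_defect; rewrite (sg_plus _ _ HT) by apply INR_mult_ge_0.
replace (Nat.iter n J (plus x y)) with (plus (Nat.iter n J x) (Nat.iter n J y)).
- linear_identity.
- induction n as [|n IH]; simpl; [easy|].
  now rewrite <- IH, resolvent_plus.
Qed.

Lemma euler_defect_scal (n : nat) (a : R) (x : E) :
  euler_defect n (scal a x) = scal a (euler_defect n x).
Proof.
unfold euler_defect; rewrite (sg_scal _ _ HT) by apply INR_mult_ge_0.
replace (Nat.iter n J (scal a x)) with (scal a (Nat.iter n J x)).
- linear_identity.
- induction n as [|n IH]; simpl; [easy|].
  now rewrite <- IH, resolvent_scal.
Qed.

Lemma euler_defect_bounded (n : nat) (x : E) (K : R) :
  orbit_bound T x K -> orbit_bound T (euler_defect n x) (2 * K).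
Proof.
intros Hx; replace (2 * K) with (K + K) by ring.
apply (orbit_bound_minus HT).
- induction n as [|n IH]; simpl; [easy|now apply orbit_bound_resolvent].
- apply (orbit_bound_orbit HT); [apply INR_mult_ge_0|easy].
Qed.

(** The bounded vector is the integral over [0, h] of
    [T s w - T h w], whose norm is at most [(h - s) K]. *)
Lemma taylor_implicit (u w z : E) (K : R) :
  neg_generator T u w -> neg_generator T w z -> orbit_bound T z K ->
  orbit_bound T (minus u (plus (T h u) (scal h (T h w)))) (h ^ 2 / 2 * K).
Proof.
intros Hu Hw Hz t Ht.
rewrite (sg_minus HT), (sg_plus _ _ HT), (sg_scal _ _ HT) by easy.
rewrite <- !(sg_add _ _ HT) by lra.
rewrite (Rplus_comm t h), !(sg_add _ _ HT) by lra.
apply (neg_generator_orbit HT t) in Hu, Hw; try easy.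
apply (orbit_bound_orbit HT t) in Hz; [|easy].
set (u' := T t u) in *; set (w' := T t w) in *; set (z' := T t z) in *.
set (f s := plus (T s u') (scal s (T h w'))).
set (g s := (h * s - s ^ 2 / 2) * K).
assert (H : norm (minus (f h) (f 0)) <= g h - g 0).
{ apply (right_mean_value f (fun s => plus (scal (-1) (T s w')) (T h w'))
           g (fun s => (h - s) * K)); [| | |lra].
  - apply (right_primitive_plus (fun s => T s u') (fun s => scal (-1) (T s w'))).
    + now apply (orbit_right_primitive HT).
    + apply right_primitive_affine.
  - intros s _; unfold g; auto_derive; [easy|field].
  - intros s Hs.
    replace h with (h - s + s) at 1 by ring.
    rewrite Rplus_comm, (sg_add _ _ HT) by lra.
    rewrite_norm_as (minus (T s (T (h - s) w')) (T s w')).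
    rewrite <- (sg_minus HT) by easy.
    apply (orbit_bound_increment HT w' z'); [easy|easy|lra|easy]. }
unfold f, g in H; rewrite (sg_zero _ _ HT) in H.
replace (h ^ 2 / 2 * K) with ((h * h - h ^ 2 / 2) * K - (h * 0 - 0 ^ 2 / 2) * K)
  by field.
apply Rle_trans with (2 := H).
rewrite_norm_as (scal (-1) (minus (plus (T h u') (scal h (T h w')))
                                  (plus u' (scal 0 (T h w'))))).
eapply Rle_trans; [apply norm_scal_le|].
rewrite Rabs_m1, Rmult_1_l; apply Rle_refl.
Qed.

(** One has [(1 + h A) (J u - T h u) = u - T h u - h T h w], and the resolvent
    is a contraction. *)
Lemma euler_one_step (u w z : E) (K : R) :
  neg_generator T u w -> neg_generator T w z -> orbit_bound T z K ->
  orbit_bound T (minus (J u) (T h u)) (h ^ 2 / 2 * K).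
Proof.
intros Hu Hw Hz.
assert (Hh0 : 0 <= h) by lra.
apply (resolvent_contraction HT h) with
  (2 := neg_generator_minus HT _ _ _ _ (HJ u) (neg_generator_orbit HT h _ _ Hh0 Hu));
  [easy|].
match goal with |- orbit_bound _ ?y _ =>
  replace y with (minus u (plus (T h u) (scal h (T h w)))) by linear_identity end.
now apply taylor_implicit with z.
Qed.

(** Telescoping: the step errors add up because [J] and [T h] do not increase
    orbit bounds. *)
Lemma euler_defect_second_order (n : nat) (u w z : E) (K : R) :
  neg_generator T u w -> neg_generator T w z -> orbit_bound T z K ->
  orbit_bound T (euler_defect n u) (INR n * (h ^ 2 / 2 * K)).
Proof.
intros Hu Hw Hz; unfold euler_defect.
induction n as [|n IH].
- simpl Nat.iter; rewrite !Rmult_0_l, (sg_zero _ _ HT), <- (Rmult_0_l (M * norm u)).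
  match goal with |- orbit_bound _ ?y _ =>
    replace y with (scal 0 u) by linear_identity end.
  apply (orbit_bound_scal HT); [lra|apply (orbit_bound_of_norm HT)].
- rewrite S_INR; simpl Nat.iter.
  assert (Hn := INR_mult_ge_0 n).
  replace ((INR n + 1) * h) with (h + INR n * h) by ring.
  rewrite (sg_add _ _ HT) by lra.
  replace ((INR n + 1) * (h ^ 2 / 2 * K))
    with (INR n * (h ^ 2 / 2 * K) + h ^ 2 / 2 * K) by ring.
  set (u' := T (INR n * h) u) in *.
  apply orbit_bound_resolvent in IH.
  assert (Hsplit : J (Nat.iter n J u) = plus (J (minus (Nat.iter n J u) u')) (J u')).
  { rewrite <- resolvent_plus; f_equal; linear_identity. }
  rewrite Hsplit.
  match goal with |- orbit_bound _ ?y _ => replace y with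
    (plus (J (minus (Nat.iter n J u) u')) (minus (J u') (T h u')))
    by linear_identity end.
  apply (orbit_bound_plus HT); [easy|].
  apply euler_one_step with (T (INR n * h) w) (T (INR n * h) z).
  + now apply (neg_generator_orbit HT).
  + now apply (neg_generator_orbit HT).
  + now apply (orbit_bound_orbit HT).
Qed.

(** Split [v] into the average of its orbit over [0, h sqrt n], which lies in
    the domain of [A^2] and obeys the second-order bound, and a remainder small
    enough for the trivial bound [2 K]. *)
Lemma euler_defect_first_order (n : nat) (v w : E) (K : R) :
  (1 <= n)%nat -> neg_generator T v w -> orbit_bound T w K ->
  orbit_bound T (euler_defect n v) (2 * (h * sqrt (INR n)) * K).
Proof.
intros Hn Hv Hw.
assert (HnR : 0 < INR n) by (apply lt_0_INR; lia).
assert (Hsq := sqrt_lt_R0 _ HnR).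
assert (Hsq2 := sqrt_sqrt (INR n) (Rlt_le _ _ HnR)).
set (s := h * sqrt (INR n)).
assert (Hs : 0 < s) by now apply Rmult_lt_0_compat.
destruct (orbit_integral HT v) as [F [F0 HF]].
set (a := scal (/ s) (F s)).
assert (Ha : neg_generator T a (scal (/ s) (minus v (T s v)))).
{ apply (neg_generator_scal HT), (orbit_integral_neg_generator HT F0 HF); lra. }
assert (Ha2 : neg_generator T (scal (/ s) (minus v (T s v)))
                              (scal (/ s) (minus w (T s w)))).
{ apply (neg_generator_scal HT), (neg_generator_minus HT); [easy|].
  apply (neg_generator_orbit HT); [lra|easy]. }
assert (Ha2K : orbit_bound T (scal (/ s) (minus w (T s w))) (/ s * (K + K))).
{ apply (orbit_bound_scal HT); [apply Rlt_le, Rinv_0_lt_compat; easy|].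
  apply (orbit_bound_minus HT); [easy|].
  apply (orbit_bound_orbit HT); [lra|easy]. }
assert (Hb : orbit_bound T (minus v a) (/ s * (s ^ 2 / 2 * K))).
{ replace (minus v a) with (scal (/ s) (minus (scal s v) (F s)))
    by (unfold a; linear_identity).
  apply (orbit_bound_scal HT); [apply Rlt_le, Rinv_0_lt_compat; easy|].
  intros t Ht.
  set (f u := T t (plus (scal u v) (scal (-1) (F u)))).
  set (g u := u ^ 2 / 2 * K).
  assert (H : norm (minus (f s) (f 0)) <= g s - g 0).
  { apply (right_mean_value f (fun u => T t (plus v (scal (-1) (T u v))))
             g (fun u => u * K)); [| | |lra].
    - apply (right_primitive_linear (T t) M); [| | |].
      + intros x y; now apply (sg_minus HT).
      + intros b x; now apply (sg_scal _ _ HT).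
      + intros x; now apply (sg_bound _ _ HT).
      + apply (right_primitive_plus (fun u => scal u v) (fun _ => v)
                 (fun u => scal (-1) (F u)) (fun u => scal (-1) (T u v))).
        * apply right_primitive_affine.
        * apply (right_primitive_linear (fun x => scal (-1) x) (Rabs (-1)) F
                   (fun u => T u v)); [| | |easy].
          -- intros x y; linear_identity.
          -- intros b x; linear_identity.
          -- intros x; apply norm_scal_le.
    - intros u _; unfold g; auto_derive; [easy|field].
    - intros u Hu.
      replace (plus v (scal (-1) (T u v))) with (scal (-1) (minus (T u v) v))
        by linear_identity.
      rewrite (sg_scal _ _ HT) by easy.
      eapply Rle_trans; [apply norm_scal_le|]; rewrite Rabs_m1, Rmult_1_l.
      now apply (orbit_bound_increment HT v w). }
  unfold f, g in H; rewrite F0, <- (sg_minus HT) in H by easy.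
  replace (s ^ 2 / 2 * K) with (s ^ 2 / 2 * K - 0 ^ 2 / 2 * K) by field.
  apply Rle_trans with (2 := H); right; do 2 f_equal; linear_identity. }
replace v with (plus (minus v a) a) by linear_identity.
rewrite euler_defect_plus.
replace (2 * s * K) with
  (2 * (/ s * (s ^ 2 / 2 * K)) + INR n * (h ^ 2 / 2 * (/ s * (K + K)))).
- apply (orbit_bound_plus HT).
  + now apply euler_defect_bounded.
  + now apply euler_defect_second_order with (1 := Ha) (2 := Ha2).
- rewrite <- Hsq2; unfold s; field; lra.
Qed.

(** [w + 2 l a + l^2 u] is [(A + l)^2 u] when [a = A u] and [w = A^2 u]. *)
Lemma euler_defect_le (n : nat) (l : R) (u a w : E) :
  (1 <= n)%nat -> 0 <= l -> neg_generator T u a -> neg_generator T a w ->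
  norm (euler_defect n (plus w (plus (scal (2 * l) a) (scal (l ^ 2) u)))) <=
  (2 + 4 * (l * (h * sqrt (INR n))) + (l * (h * sqrt (INR n))) ^ 2 / 2)
    * (M * norm w).
Proof.
intros Hn Hl Hu Ha.
assert (Hw := orbit_bound_of_norm HT w).
assert (Hsq2 := sqrt_sqrt (INR n) (pos_INR n)).
rewrite !euler_defect_plus, !euler_defect_scal.
apply (norm_le_orbit_bound HT).
replace (_ * (M * norm w)) with
  (2 * (M * norm w) + ((2 * l) * (2 * (h * sqrt (INR n)) * (M * norm w))
   + l ^ 2 * (INR n * (h ^ 2 / 2 * (M * norm w))))).
- apply (orbit_bound_plus HT); [|apply (orbit_bound_plus HT)].
  + now apply euler_defect_bounded.
  + apply (orbit_bound_scal HT); [lra|].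
    now apply euler_defect_first_order with w.
  + apply (orbit_bound_scal HT); [apply pow2_ge_0|].
    now apply euler_defect_second_order with a w.
- set (q := sqrt (INR n)) in *; clearbody q; rewrite <- Hsq2; field.
Qed.

End Euler.

(** * Back to complex operators *)

Section Bridge.
Context {X : CompleteNormedModule C_AbsRing}.

Lemma filterlim_at_right_norm (f : R -> X) (y : X) :
  filterlim f (at_right 0) (locally y) <->
  forall eps, 0 < eps -> exists delta, 0 < delta /\
    forall h, 0 < h < delta -> norm (minus (f h) y) <= eps.
Proof.
split.
- intros H eps Heps.
  assert (Hf := @norm_factor_gt_0 C_AbsRing X).
  assert (He : 0 < eps / @norm_factor C_AbsRing X) by now apply Rdiv_lt_0_compat.
  destruct (proj1 (filterlim_locally f y) H (mkposreal _ He)) as [d Hd].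
  exists d; split; [apply cond_pos|]; intros h Hh; left.
  replace eps with (@norm_factor C_AbsRing X * (eps / @norm_factor C_AbsRing X))
    by (field; lra).
  refine (norm_compat2 y (f h) (mkposreal _ He) (Hd h _ _)); [|easy].
  change (Rabs (h - 0) < d); rewrite Rminus_0_r, Rabs_pos_eq; lra.
- intros H; apply filterlim_locally; intros eps.
  assert (He := cond_pos eps).
  destruct (H (eps / 2)) as [d [Hd Hh]]; [lra|].
  exists (mkposreal d Hd); intros h Hb Hpos.
  change (Rabs (h - 0) < d) in Hb.
  rewrite Rminus_0_r, Rabs_pos_eq in Hb by lra.
  refine (norm_compat1 y (f h) eps _).
  eapply Rle_lt_trans; [apply Hh; lra|lra].
Qed.

Context {T : R -> X -> X} (hT : C0_semigroup T) {M : R}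
        (hM : semigroup_sup T = Finite M).

Lemma semigroup_sup_unit_ball (t : R) (x : X) :
  0 <= t -> norm x <= 1 -> norm (T t x) <= M.
Proof.
intros Ht Hx.
assert (Hsup := hM); unfold semigroup_sup, Rbar_lub in Hsup.
destruct (Rbar_ex_lub _) as [l [Hub Hleast]]; simpl in Hsup; subst l.
assert (H1 : Rbar_le (op_norm (T t)) M) by (apply Hub; now exists t).
destruct (Lub_Rbar_correct
  (fun r => exists x, norm x <= 1 /\ r = norm (T t x))) as [H2 _].
assert (H3 := H2 (norm (T t x)) (ex_intro _ x (conj Hx eq_refl))).
exact (Rbar_le_trans _ _ _ H3 H1).
Qed.

Lemma norm_semigroup_le (t : R) (x : X) : 0 <= t -> norm (T t x) <= M * norm x.
Proof.
intros Ht; assert (Hlin := C0_linear hT Ht).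
set (r := norm x).
assert (Hr : 0 <= r) by apply norm_ge_0.
assert (Hscal : forall a : R, norm (T t (scal (RtoC a : C_AbsRing) x)) =
                  norm (scal (RtoC a : C_AbsRing) (T t x)))
  by (intros a; now rewrite (linear_scal _ Hlin)).
destruct Hr as [Hr | Hr].
- assert (Hunit : norm (T t (scal (RtoC (/ r) : C_AbsRing) x)) <= M).
  { apply semigroup_sup_unit_ball; [easy|].
    eapply Rle_trans;
      [exact (@norm_scal_nonneg (real_form X) (/ r) x
               (Rlt_le _ _ (Rinv_0_lt_compat _ Hr)))|].
    change (/ r * r <= 1); rewrite Rinv_l by lra; apply Rle_refl. }
  rewrite Hscal in Hunit.
  apply Rle_trans with (r * norm (scal (RtoC (/ r) : C_AbsRing) (T t x))).
  + eapply Rle_trans; [|exact (@norm_scal_nonneg (real_form X) r _ (Rlt_le _ _ Hr))].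
    right; symmetry.
    assert (Hid : forall y : real_form X, scal r (scal (/ r) y) = y)
      by (intros y; linear_identity).
    exact (f_equal (@norm R_AbsRing (real_form X)) (Hid (T t x))).
  + rewrite Rmult_comm; apply Rmult_le_compat_r; lra.
- rewrite <- Hr, Rmult_0_r.
  assert (Hx0 : x = zero) by exact (norm_eq_zero x (eq_sym Hr)).
  assert (H0 : scal (RtoC 0 : C_AbsRing) x = x)
    by (rewrite Hx0; exact (scal_zero_r (V := X) (RtoC 0 : C_AbsRing))).
  specialize (Hscal 0); rewrite H0 in Hscal; rewrite Hscal.
  eapply Rle_trans; [exact (@norm_scal_le (real_form X) 0 (T t x))|].
  rewrite Rabs_R0, Rmult_0_l; apply Rle_refl.
Qed.

Lemma C0_bounded_semigroup : @bounded_semigroup (real_form X) T M.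
Proof.
split.
- intros t x y Ht; exact (linear_plus _ (C0_linear hT Ht) x y).
- intros t a x Ht; exact (linear_scal _ (C0_linear hT Ht) (RtoC a) x).
- exact (C0_zero hT).
- exact (fun s t x => @C0_add X T hT s t x).
- exact norm_semigroup_le.
- apply Rle_trans with (norm (T 0 (zero : X))); [apply norm_ge_0|].
  apply semigroup_sup_unit_ball; [lra|].
  apply Rle_trans with 0; [right; exact (norm_zero (V := X))|lra].
- intros x; exact (proj1 (filterlim_at_right_norm (fun t => T t x) x)
                     (@C0_continuous X T hT x)).
Qed.

Lemma filterlim_diff_quotient (v w : X) :
  filterlim (diff_quotient T v) (at_right 0) (locally (opp w)) <->
  @neg_generator (real_form X) T v w.
Proof.
rewrite filterlim_at_right_norm; unfold neg_generator.
assert (Hq : forall h, 0 < h ->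
  (minus (diff_quotient T v h) (opp w) : real_form X) =
  scal (/ h) (plus (minus (T h v) v : real_form X) (scal h (w : real_form X)))).
{ intros h Hh.
  assert (Hid : forall a b c : real_form X,
    minus (scal (/ h) (minus a b)) (opp c) =
    scal (/ h) (plus (minus a b) (scal h c)))
    by (intros a b c; linear_identity).
  exact (Hid (T h v) v w). }
split; intros H eps Heps; destruct (H eps Heps) as [d [Hd Hh]];
  exists d; (split; [easy|]); intros h Hh0; specialize (Hh h Hh0);
  assert (Hi : 0 < / h) by (apply Rinv_0_lt_compat; lra);
  assert (G := Hq h (proj1 Hh0)).
- assert (Hid : forall y z : real_form X, z = scal (/ h) y -> y = scal h z)
    by (intros y z ->; linear_identity).
  eapply Rle_trans;
    [right; exact (f_equal (@norm R_AbsRing (real_form X)) (Hid _ _ G))|].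
  eapply Rle_trans; [apply norm_scal_nonneg; lra|].
  rewrite Rmult_comm; apply Rmult_le_compat_r; [lra|exact Hh].
- eapply Rle_trans; [right; exact (f_equal (@norm R_AbsRing (real_form X)) G)|].
  eapply Rle_trans; [apply norm_scal_nonneg; lra|].
  replace eps with (/ h * (eps * h)) by (field; lra).
  apply Rmult_le_compat_l; [lra|exact Hh].
Qed.

Context {A : operator X} (hA : is_generator T (op_opp A)).

Lemma generator_neg_generator (v w : X) :
  op_dom A v /\ A v = w <-> @neg_generator (real_form X) T v w.
Proof.
destruct hA as [Hdom Hval]; simpl in Hdom, Hval.
split.
- intros [Hv <-]; apply filterlim_diff_quotient; now apply Hval.
- intros H; assert (Hv : op_dom A v).
  { apply Hdom; exists (opp w); now apply filterlim_diff_quotient. }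
  split; [easy|].
  refine (neg_generator_unique (E := real_form X) (T := T) v (A v) w _ H).
  apply filterlim_diff_quotient; now apply Hval.
Qed.

Lemma op_inv_spec (B : operator X) (y : X) :
  (exists! x, op_dom B x /\ B x = y) ->
  op_dom (op_inv B) y /\ op_dom B (op_inv B y) /\ B (op_inv B y) = y.
Proof.
intros H; split; [exact H|].
exact (iota_correct (fun x => op_dom B x /\ B x = y) H).
Qed.

(** The resolvent equation is solved by a Laplace transform, and its solution is
    unique because [1 + h A] does not decrease orbit bounds. *)
Lemma op_inv_euler (h : R) (x : X) :
  0 < h ->
  let J := op_inv (op_plus op_id (op_scal (RtoC h) A)) in
  op_dom J x /\
  @neg_generator (real_form X) T (J x)
    (scal (/ h) (minus (x : real_form X) (J x))).
Proof.
intros Hh J.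
assert (Hex : exists! v, op_dom (op_plus op_id (op_scal (RtoC h) A)) v /\
                op_plus op_id (op_scal (RtoC h) A) v = x).
{ destruct (neg_generator_resolvent_exists C0_bounded_semigroup h x Hh)
    as [v [w [Hv Hx]]].
  exists v; split.
  - destruct (proj2 (generator_neg_generator v w) Hv) as [Hd Hw]; simpl.
    split; [easy|]; rewrite Hw; exact Hx.
  - intros v' [[_ Hd'] Hx']; simpl in Hd', Hx'.
    refine (neg_generator_resolvent_unique C0_bounded_semigroup h v w v' (A v')
              Hh Hv _ _).
    + now apply generator_neg_generator.
    + rewrite Hx; symmetry; exact Hx'. }
destruct (op_inv_spec _ _ Hex) as [Hdom [[_ HdA] Heq]]; fold J in Hdom, HdA, Heq.
split; [exact Hdom|].
replace (scal (/ h) (minus (x : real_form X) (J x))) with (A (J x) : real_form X).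
- now apply generator_neg_generator.
- rewrite <- Heq at 2.
  assert (Hid : forall a b : real_form X, a = scal (/ h) (minus (plus b (scal h a)) b))
    by (intros a b; linear_identity).
  exact (Hid (A (J x)) (J x)).
Qed.

(** The resolvent equation of [1 + A / l], multiplied by [l]; here [v] is
    [(A + l)^-1 x]. *)
Lemma op_comp_resolvent (l : R) (x : X) :
  0 < l ->
  exists v : X,
    @neg_generator (real_form X) T v
      (op_comp A (op_inv (op_plus A (op_scal (RtoC l) op_id))) x) /\
    plus (op_comp A (op_inv (op_plus A (op_scal (RtoC l) op_id))) x : real_form X)
         (scal l (v : real_form X)) = x.
Proof.
intros Hl.
set (B := op_plus A (op_scal (RtoC l) op_id)).
assert (Hi : 0 < / l) by now apply Rinv_0_lt_compat.
assert (Hex : exists! v, op_dom B v /\ B v = x).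
{ destruct (neg_generator_resolvent_exists C0_bounded_semigroup (/ l)
              (scal (/ l) (x : real_form X)) Hi) as [v [w [Hv Hx]]].
  assert (Hid : forall a b c : real_form X,
    plus a (scal (/ l) b) = scal (/ l) c -> plus b (scal l a) = c).
  { intros a b c Hc.
    transitivity (scal l (plus a (scal (/ l) b)) : real_form X);
      [linear_identity|].
    rewrite Hc; linear_identity. }
  assert (Hx' := Hid v w x Hx); clear Hid.
  exists v; split.
  - destruct (proj2 (generator_neg_generator v w) Hv) as [Hd Hw]; simpl.
    split; [easy|]; rewrite Hw; exact Hx'.
  - intros v' [[Hd' _] Hxv]; simpl in Hd', Hxv.
    refine (neg_generator_resolvent_unique C0_bounded_semigroup (/ l) v w v' (A v')
              Hi Hv _ _).
    + now apply generator_neg_generator.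
    + rewrite Hx, <- Hxv.
      assert (Hid : forall a b : real_form X,
        scal (/ l) (plus a (scal l b)) = plus b (scal (/ l) a))
        by (intros a b; linear_identity).
      exact (Hid (A v') v'). }
destruct (op_inv_spec _ _ Hex) as [_ [[HdA _] Heq]].
exists (op_inv B x); split.
- now apply generator_neg_generator.
- exact Heq.
Qed.

(** Expands [(A + l)^2 u = x] for [u = (A + l)^-2 x] and [a = A u]. *)
Lemma komatsu_decomposition (l : R) (x : X) :
  0 < l ->
  exists u a : real_form X,
    @neg_generator (real_form X) T u a /\
    @neg_generator (real_form X) T a (komatsu_op A l x) /\
    (x : real_form X) = plus (komatsu_op A l x : real_form X)
                          (plus (scal (2 * l) a) (scal (l ^ 2) u)).
Proof.
intros Hl.
destruct (op_comp_resolvent l x Hl) as [v1 [Hv1 Hx1]].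
change (komatsu_op A l x) with
  (op_comp A (op_inv (op_plus A (op_scal (RtoC l) op_id)))
    (op_comp A (op_inv (op_plus A (op_scal (RtoC l) op_id))) x)).
set (b := op_comp A (op_inv (op_plus A (op_scal (RtoC l) op_id))) x) in *.
destruct (op_comp_resolvent l b Hl) as [v2 [Hv2 Hx2]].
set (w := op_comp A (op_inv (op_plus A (op_scal (RtoC l) op_id))) b) in *.
exists (scal (/ l) (minus (v1 : real_form X) v2)), v2; split; [|split; [easy|]].
- assert (Hid : forall y z c : real_form X, plus y (scal l z) = c ->
                  scal (/ l) (minus c y) = z)
    by (intros y z c <-; linear_identity).
  rewrite <- (Hid w v2 b Hx2) at 2.
  now apply (neg_generator_scal C0_bounded_semigroup),
    (neg_generator_minus C0_bounded_semigroup).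
- assert (Hid : forall y z z' c c' : real_form X,
    plus y (scal l z) = c -> plus c (scal l z') = c' ->
    c' = plus y (plus (scal (2 * l) z) (scal (l ^ 2) (scal (/ l) (minus z' z)))))
    by (intros y z z' c c' <- <-; linear_identity).
  exact (Hid w v2 v1 b x Hx2 Hx1).
Qed.

End Bridge.

Lemma op_pow_total {X : CompleteNormedModule C_AbsRing} (B : operator X) (n : nat) :
  (forall x, op_dom B x) ->
  forall x, op_dom (op_pow B n) x /\ op_pow B n x = Nat.iter n B x.
Proof.
intros HB x; induction n as [|n [IHd IH]]; simpl; [easy|].
split; [split; [easy|apply HB]|now rewrite IH].
Qed.

Lemma komatsu_norm_bound {X : CompleteNormedModule C_AbsRing}
  (A : operator X) (alpha l : R) (x : X) :
  komatsu_space A alpha x -> 0 < l ->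
  Rpower l alpha * norm (komatsu_op A l x) <= real (komatsu_norm A alpha x).
Proof.
unfold komatsu_space, komatsu_norm; intros Hx Hl.
destruct (Lub_Rbar_correct (fun r => exists lambda, 0 < lambda /\
  r = Rpower lambda alpha * norm (komatsu_op A lambda x))) as [Hub _].
specialize (Hub _ (ex_intro _ l (conj Hl eq_refl))).
assert (Hn := norm_ge_0 x).
destruct (Lub_Rbar _) as [N | |]; simpl in *; try easy; lra.
Qed.

Theorem theorem5p4
  (X : CompleteNormedModule C_AbsRing)
  (T : R -> X -> X) (A : operator X)
  (hT : C0_semigroup T)
  (hA : is_generator T (op_opp A))
  (M : R) (hM : semigroup_sup T = Finite M)
  (alpha : R) (halpha : 0 < alpha <= 2)
  (x : X) (hx : komatsu_space A alpha x)
  (n : nat) (hn : (1 <= n)%nat) (t : R) (ht : 0 < t) :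
  op_dom (euler_error A T n t) x /\
  norm (euler_error A T n t x)
    <= 8 * M * Rpower (t / sqrt (INR n)) alpha * real (komatsu_norm A alpha x).
Proof.
assert (HT := C0_bounded_semigroup hT hM).
assert (HM := sg_bound_ge_0 _ _ HT).
assert (HnR : 0 < INR n) by (apply lt_0_INR; lia).
assert (Hq := sqrt_lt_R0 _ HnR).
assert (Hq2 := sqrt_sqrt (INR n) (Rlt_le _ _ HnR)).
set (h := t / INR n).
assert (Hh : 0 < h) by now apply Rdiv_lt_0_compat.
set (s := t / sqrt (INR n)).
assert (Hs : 0 < s) by now apply Rdiv_lt_0_compat.
assert (Hi : 0 < / s) by now apply Rinv_0_lt_compat.
assert (Hhs : h * sqrt (INR n) = s).
{ unfold h, s; set (q := sqrt (INR n)) in *; clearbody q.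
  rewrite <- Hq2; field; lra. }
set (J := op_inv (op_plus op_id (op_scal (RtoC h) A))).
assert (HJ := fun y => proj2 (op_inv_euler hT hM hA h y Hh)).
assert (Hpow := op_pow_total J n
                  (fun y => proj1 (op_inv_euler hT hM hA h y Hh)) x).
split; [split; [apply Hpow|exact I]|].
assert (Herr : euler_error A T n t x = euler_defect (E := real_form X) (T := T) (h := h) (J := J) n x).
{ unfold euler_error, euler_defect; simpl; fold h J.
  rewrite (proj2 Hpow).
  replace (INR n * h) with t by (unfold h; field; lra); reflexivity. }
(* The Komatsu norm is used at the single scale [/ s], for which the
   constant of the defect bound is [2 + 4 + 1/2]. *)
destruct (komatsu_decomposition hT hM hA (/ s) x Hi) as [u [a [Hu [Ha Hx]]]].
set (w := komatsu_op A (/ s) x) in *.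
assert (Hle := euler_defect_le HT Hh HJ n (/ s) u a w hn (Rlt_le _ _ Hi) Hu Ha).
rewrite <- Hx, Hhs, Rinv_l in Hle by lra.
rewrite Herr.
assert (HN := komatsu_norm_bound A alpha (/ s) x hx Hi); fold w in HN.
set (N := real (komatsu_norm A alpha x)) in *.
apply Rle_trans with (1 := Hle).
assert (Hpos : 0 < Rpower s alpha) by apply exp_pos.
assert (Hinv : Rpower s alpha * Rpower (/ s) alpha = 1).
{ rewrite Rpower_mult_distr, Rinv_r by lra; unfold Rpower.
  rewrite ln_1, Rmult_0_r; apply exp_0. }
assert (Hw : norm w <= Rpower s alpha * N).
{ apply Rle_trans with (Rpower s alpha * (Rpower (/ s) alpha * norm w)).
  - rewrite <- Rmult_assoc, Hinv; lra.
  - apply Rmult_le_compat_l; lra. }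
assert (Hw0 := norm_ge_0 w).
assert (HMw : M * norm w <= M * (Rpower s alpha * N)) by now apply Rmult_le_compat_l.
assert (HMw0 : 0 <= M * norm w) by now apply Rmult_le_pos.
change (@norm R_AbsRing (real_form X) w) with (norm w).
replace (8 * M * Rpower s alpha * N) with (8 * (M * (Rpower s alpha * N))) by ring.
lra.
Qed.
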